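(* Let $\phi$ be the Laplace exponent (Bernstein function, not identically zero) of a potentially killed driftless subordinator whose Lévy measure $\mu$ has positive increase, and assume $\limsup_{x\to0+}\bar\mu(2x)/\bar\mu(x)<1$. Then there exist $\varepsilon>0$ and positive constants $a_0,b_0$ such that for any $a\ge a_0$ and $|b|\ge b_0a$, $$A_{\phi_*}(a+ib)\ge\varepsilon|b|-\varepsilon b_0a .$$ As a result, $\phi\in\mathcal B_{exp}(\varepsilon)$. This, in particular, is true if $\phi$ is driftless and $\bar\mu(y)\sim y^{-\alpha}l(y)$ as $y\to0+$, where $\alpha\in(0,1)$ and $l$ is a slowly varying function at zero.
   Context: A potentially killed subordinator has Laplace exponent $$\phi(z)=q+dz+\int_0^\infty(1-e^{-zy})\,\mu(\mathrm dy)=q+dz+z\int_0^\infty e^{-zy}\bar\mu(y)\,\mathrm dy,\qquad\mathrm{Re}(z)\ge0,$$ with $q,d\ge0$, $\mu$ a measure on $(0,\infty)$ with $\int_0^\infty\min\{y,1\}\mu(\mathrm dy)<\infty$, and $\bar\mu(y)=\mu((y,\infty))$. Such functions are exactly the Bernstein functions; their class is denoted $\mathcal B$. Driftless means $d=0$. Positive increase means $$\liminf_{x\to0+}\frac{\int_0^{2x}\bar\mu(y)\,\mathrm dy}{\int_0^x\bar\mu(y)\,\mathrm dy}>1,\quad\text{equivalently}\quad\limsup_{x\to\infty}\frac{x\phi'(x)}{\phi(x)}<1.$$ For $\mathrm{Re}(z)>0$ put $\phi_*(z)=z/\phi(z)$, and for $a>0$, $b\in\mathbb R$, $$A_{\phi_*}(a+ib)=\int_0^b\arg\phi_*(a+iw)\,\mathrm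 dw,$$ with $\arg$ in $(-\pi,\pi]$. The Bernstein–gamma function $W_\phi$ is the solution of $W_\phi(z+1)=\phi(z)W_\phi(z)$, $W_\phi(1)=1$, $\mathrm{Re}(z)>0$, which is the Mellin transform of a non-negative random variable, i.e. $W_\phi(z)=\mathbb E[Y_\phi^{z-1}]$ for some random variable $Y_\phi$. For $\theta>0$, $$\mathcal B_{exp}(\theta)=\left\{\phi\in\mathcal B:\ \forall a>0,\ \forall\epsilon\in(0,\theta):\ \lim_{|b|\to\infty}e^{(\theta-\epsilon)|b|}\left|\frac{\Gamma(a+ib)}{W_\phi(a+ib)}\right|=0\right\}.$$ *)

(* Defs.v *)
From HB Require Import structures.
From mathcomp Require Import all_boot all_order all_algebra.
From mathcomp Require Import all_classical all_reals all_analysis.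
From mathcomp Require Import complex.

Set Implicit Arguments.
Unset Strict Implicit.
Unset Printing Implicit Defensive.

Import Order.TTheory GRing.Theory Num.Theory.
Import numFieldNormedType.Exports.

Local Open Scope classical_set_scope.
Local Open Scope ring_scope.
Local Open Scope complex_scope.

Definition cexp (R : realType) (z : R[i]) : R[i] :=
  (expR (complex.Re z) * cos (complex.Im z)) +i*
  (expR (complex.Re z) * sin (complex.Im z)).

(* x ^ w for x > 0; the value at x <= 0 is meaningless (ln x = 0 there). *)
Definition cpow (R : realType) (x : R) (w : R[i]) : R[i] :=
  cexp (w * (ln x)%:C).

(* Principal argument in (-pi, pi]; carg 0 is meaningless. *)
Definition carg (R : realType) (z : R[i]) : R :=
  let t := acos (complex.Re z / Normc.normc z) in
  if 0 <= complex.Im z then t else - t.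

(* Componentwise, hence meaningful only when both components are integrable. *)
Definition cintegral d (T : measurableType d) (R : realType)
    (mu : {measure set T -> \bar R}) (D : set T) (f : T -> R[i]) : R[i] :=
  (\int[mu]_(x in D) complex.Re (f x)) +i*
  (\int[mu]_(x in D) complex.Im (f x)).

(* The integral from 0 to b, with the usual sign convention when b < 0. *)
Definition integral_from0 (R : realType) (f : R -> R) (b : R) : R :=
  if 0 <= b then \int[lebesgue_measure]_(w in `[0, b]) f w
  else - \int[lebesgue_measure]_(w in `[b, 0]) f w.

Definition cGamma (R : realType) (z : R[i]) : R[i] :=
  cintegral (@lebesgue_measure R) `]0, +oo[
    (fun t => cpow t (z - 1) * (expR (- t))%:C).

(* A measure on (0, +oo) is represented by one on R that does not charge
   (-oo, 0]. *)
Definition levy_measure (R : realType)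
    (mu : {measure set (measurableTypeR R) -> \bar R}) : Prop :=
  mu `]-oo, 0]%classic = 0%E /\
  (\int[mu]_(y in `]0%R, +oo[) (Num.min y 1%R)%:E < +oo)%E.

(* Finite for x > 0 when mu is a Levy measure, so fine loses nothing there. *)
Definition levy_tail (R : realType)
    (mu : {measure set (measurableTypeR R) -> \bar R}) (x : R) : R :=
  fine (mu `]x, +oo[%classic).

Definition laplace_exponent (R : realType) (q d : R)
    (mu : {measure set (measurableTypeR R) -> \bar R}) (z : R[i]) : R[i] :=
  q%:C + d%:C * z + cintegral mu `]0, +oo[ (fun y => 1 - cexp (- z * y%:C)).

Definition bernstein (R : realType) (phi : R[i] -> R[i]) : Prop :=
  exists (q d : R) (mu : {measure set (measurableTypeR R) -> \bar R}),
    [/\ 0 <= q, 0 <= d, levy_measure mu &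
        forall z : R[i], 0 <= complex.Re z -> phi z = laplace_exponent q d mu z].

Definition not_identically_zero (R : realType) (phi : R[i] -> R[i]) : Prop :=
  exists z : R[i], 0 <= complex.Re z /\ phi z <> 0.

Definition positive_increase (R : realType)
    (mu : {measure set (measurableTypeR R) -> \bar R}) : Prop :=
  let I (x : R) : R := \int[lebesgue_measure]_(y in `]0, x]) levy_tail mu y in
  (1 < limf_einf (fun x : R => (I (2 * x) / I x)%:E) 0^'+)%E.

Definition phi_star (R : realType) (phi : R[i] -> R[i]) (z : R[i]) : R[i] :=
  z / phi z.

(* A_f (a + ib) *)
Definition A_fun (R : realType) (f : R[i] -> R[i]) (a b : R) : R :=
  integral_from0 (fun w => carg (f (a +i* w))) b.

(* W is the Bernstein-gamma function of phi on the half-plane Re z > 0.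
   Finiteness of E[Y^(a-1)] for 0 < a < 1 forces Y > 0 almost surely; this is
   stated separately because powR and cpow are finite at 0.  The moments
   E[Y^n] = phi 1 * ... * phi n determine the law of Y, so at most one W
   qualifies. *)
Definition is_bernstein_gamma (R : realType) (phi W : R[i] -> R[i]) : Prop :=
  [/\ W 1 = 1,
      forall z : R[i], 0 < complex.Re z -> W (z + 1) = phi z * W z &
      exists (d : measure_display) (T : measurableType d)
             (P : probability T R) (Y : {RV P >-> R}),
        [/\ forall t, 0 <= Y t,
            {ae P, forall t, 0 < Y t} &
            forall z : R[i], 0 < complex.Re z ->
              P.-integrable setT (fun t => (Y t `^ (complex.Re z - 1))%:E) /\
              W z = cintegral P setT (fun t => cpow (Y t) (z - 1))]].

(* A nonzero Bernstein function has exactly one Bernstein-gamma function, so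
   quantifying over all W names it. *)
Definition B_exp (R : realType) (theta : R) (phi : R[i] -> R[i]) : Prop :=
  [/\ bernstein phi, not_identically_zero phi &
      forall W : R[i] -> R[i], is_bernstein_gamma phi W ->
      forall a eps : R, 0 < a -> 0 < eps -> eps < theta ->
        let g (b : R) : R := expR ((theta - eps) * `|b|) *
          Normc.normc (cGamma (a +i* b) / W (a +i* b)) in
        g b @[b --> +oo%R] --> (0 : R) /\ g b @[b --> -oo%R] --> (0 : R)].

(* l need only be positive and measurable in a right neighbourhood of 0. *)
Definition slowly_varying_at0 (R : realType) (l : R -> R) : Prop :=
  [/\ exists2 x0 : R, 0 < x0 &
        measurable_fun `]0, x0[ l /\ forall x, 0 < x < x0 -> 0 < l x &
      forall c : R, 0 < c -> l (c * x) / l x @[x --> 0^'+] --> (1 : R)].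

(* Main.v *)
From mathcomp Require Import all_boot all_order all_algebra.
From mathcomp Require Import all_classical all_reals all_analysis.
From mathcomp Require Import measurable_realfun complex ring lra.
Require Import Defs.

Set Implicit Arguments.
Unset Strict Implicit.
Unset Printing Implicit Defensive.

Import Order.TTheory GRing.Theory Num.Theory.
Import numFieldNormedType.Exports.

Local Open Scope classical_set_scope.
Local Open Scope ring_scope.
Local Open Scope complex_scope.

(** Write phi(z) = q + int (1 - e^(-zy)) mu(dy), z = a + ib, T(x) for the tail
mu(]x, +oo[) and m(x) = int min(y, x) mu(dy), which is also the integral of T
over ]0, x]. Everything follows from three properties of mu near 0: T(x) > 0,
m(x) <= C x T(x), and T(2x) <= rho T(x) with rho < 1. The last one is the limsup
assumption.
Positive increase gives the first two: m(x) - m(x/2) and the increments of the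
integrated tail I over dyadic intervals are comparable, so m <= 2 I, while
(r - 1) I(x) <= I(2x) - I(x) <= x T(x). In the regularly varying case
T(2x)/T(x) tends to 2^(-alpha), which lies in ]1/2, 1[, and summing the
geometric series of the m(x/2^k) - m(x/2^(k+1)) gives the second property
([positive_increase_small_jumps], [regular_variation_ratio],
[levy_min_le_regular]).

Argument. The sign of arg (z / phi(z)) is that of Im (z * conj (phi(z))), which
for b = w > 0 equals q w + int j dmu for an explicit kernel j. It is nonnegative
because |sin u| <= u and 1 + u <= e^u. When a <= w it is at least a multiple of
w (q + T(1/w)): the kernel is at least a multiple of w on 1 < w y <= 2, and
T(2x) <= rho T(x) says that these jumps have mass at least (1 - rho) T(1/w). On
the other side |z| |phi(z)| <= 2 w (q + 2 w m(1/w)) is at most a multiple of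
the same quantity. As arg >= sin arg, the argument is bounded below by a
positive constant on a <= w, and it is nonnegative for all w >= 0; integrating
gives the bound on A with b0 = 1 ([arg_phi_star_ge], [A_fun_ge]).

Decay of Gamma / W. The two functional equations reduce the value at z to the
one at z + n. There |Gamma(z + n)| <= Gamma(a + n). In the other direction,
under the law of Y tilted by Y^(a+n-1) the variable Y / phi(a + n) has mean 1
and variance phi(a+n+1)/phi(a+n) - 1 <= 1/(a+n); hence Y^(ib) is nearly constant
and |W(z + n)| >= W(a + n)/2 for large n ([W_norm_ge]). Therefore
|Gamma(z)/W(z)| is at most a constant times the product over k of the ratios of
|phi/id| at a + k + ib and at a + k. Each ratio is at most 1 since
|1 - e^(-zy)| / |z| <= (1 - e^(-ty)) / t for t = Re z. If moreover
|b| <= t <= 3 |b| then, for y >= 8/|b|, the exponentials are negligible and this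
inequality gains a factor smaller than 1; because m(x) <= C x T(x), those jumps
carry a fixed proportion of phi(t), so the ratio is at most 1 - delta
([exponent_ratio_lt]). About |b| of the factors are of this kind, whence a bound
by exp (- delta |b|) up to a constant ([gamma_W_ratio_le]). The epsilon of the
statement is the smaller of the two constants so obtained. *)

(** * Real inequalities behind the kernel estimates *)

(** Mean value theorem in the form that turns an inequality between
    derivatives on the half-line into one between functions. *)
Lemma ge0_derive_homo (R : realType) (f df : R -> R) :
  (forall x : R, is_derive x (1 : R) f (df x)) -> (forall x, 0 <= x -> 0 <= df x) ->
  forall x, 0 <= x -> f 0 <= f x.
Proof.
move=> fdf df0 x; rewrite le_eqVlt => /predU1P[<-//|x0].
have [|c] := @MVT R f df 0 x x0 (fun z _ => fdf z).
  by apply: derivable_within_continuous => z _; exact: ex_derive.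
rewrite in_itv/= => /andP[c0 _] fE.
by rewrite -subr_ge0 fE mulr_ge0 ?df0 ?subr0 // ltW.
Qed.

Lemma sin_le (R : realType) (x : R) : 0 <= x -> sin x <= x.
Proof.
move=> x0; rewrite -subr_ge0.
have := @ge0_derive_homo R (fun x => x - sin x) (fun x => 1 - cos x) _ _ x x0.
rewrite sin0 subr0; apply.
by move=> z z0; rewrite subr_ge0 cos_le1.
Qed.

Lemma norm_sin_le (R : realType) (x : R) : `|sin x| <= `|x|.
Proof.
wlog x0 : x / 0 <= x.
  move=> h; have [|x0] := leP 0 x; first exact: h.
  by rewrite -normrN -sinN -[leRHS]normrN h// oppr_ge0 ltW.
rewrite (ger0_norm x0) ler_norml sin_le// andbT -subr_ge0 opprK.
have := @ge0_derive_homo R (fun x => sin x + x) (fun x => cos x + 1) _ _ x x0.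
rewrite sin0 addr0; apply.
by move=> z z0; rewrite -(opprK 1) subr_ge0 cos_geN1.
Qed.

Lemma onem_cosE (R : realType) (x : R) : 1 - cos x = 2 * sin (x / 2) ^+ 2.
Proof.
have {1}-> : x = (x / 2) *+ 2 by rewrite -mulr_natr mulfVK.
rewrite cos_mulr2n cos2sin2 mulrnBl; ring.
Qed.

Lemma onem_cos_le (R : realType) (x : R) : 1 - cos x <= x ^+ 2 / 2.
Proof.
rewrite onem_cosE.
have : sin (x / 2) ^+ 2 <= (x / 2) ^+ 2.
  by rewrite -[leLHS]real_normK ?num_real// -[leRHS]real_normK ?num_real//
     lerXn2r ?nnegrE// norm_sin_le.
by move: (sin _ ^+ 2) => s; nra.
Qed.

Lemma expR_ge_quad (R : realType) (x : R) : 0 <= x ->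
  1 + x + x ^+ 2 / 2 <= expR x.
Proof.
move=> x0.
have := @ge0_derive_homo R (fun x => expR x - x - x * x / 2)
  (fun x => expR x - 1 - x) _ _ x x0.
rewrite expR0 mul0r mul0r !subr0 => H.
suff: 1 <= expR x - x - x * x / 2 by rewrite expr2; lra.
apply: H => [z|z z0]; last by have := expR_ge1Dx z; lra.
by apply: is_derive_eq; rewrite /GRing.scale/=; field.
Qed.

(** This is u/2 <= sinh (u/2) squared, in terms of the decreasing exponential;
    it follows from the second-order expansion of exp. *)
Lemma sqr_mul_expRN_le (R : realType) (u : R) : 0 <= u ->
  u ^+ 2 * expR (- u) <= (1 - expR (- u)) ^+ 2.
Proof.
move=> u0; have s0 : 0 <= u / 2 by rewrite divr_ge0.
have Eu : expR (- u) = expR (- (u / 2)) ^+ 2.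
  by rewrite -expRM_natl; congr expR; field.
rewrite Eu -exprMn; have := expR_ge_quad s0; set s := u / 2.
have -> : u = 2 * s by rewrite /s; field.
rewrite expRN; set g := expR s => hg.
have g0 : 0 < g by exact: expR_gt0.
have gs : 1 + s ^+ 2 <= (g - s) ^+ 2.
  have : (1 + s ^+ 2 / 2) ^+ 2 <= (g - s) ^+ 2.
    by rewrite lerXn2r ?nnegrE; have := sqr_ge0 s; lra.
  by have := sqr_ge0 (s ^+ 2); lra.
have h : 2 * s * g^-1 <= 1 - g^-1 ^+ 2.
  rewrite -subr_ge0.
  have -> : 1 - g^-1 ^+ 2 - 2 * s / g = ((g - s) ^+ 2 - (1 + s ^+ 2)) / g ^+ 2.
    by field; rewrite gt_eqF.
  by rewrite divr_ge0 ?sqr_ge0// subr_ge0.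
by rewrite lerXn2r ?nnegrE// ?(le_trans _ h)// ?mulr_ge0 ?invr_ge0// ltW.
Qed.

(** The squared modulus of 1 - E e^(-iv), split into its value at v = 0 and
    the contribution of the rotation. *)
Lemma sqr_norm_onem_exp (R : realType) (E v : R) :
  (1 - E * cos v) ^+ 2 + (E * sin v) ^+ 2 = (1 - E) ^+ 2 + 2 * E * (1 - cos v).
Proof. rewrite [(E * sin v) ^+ 2]exprMn sin2cos2; ring. Qed.

(** The kernel (1 - e^(-zy))/z is the integral of e^(-zs) over [0, y], so its
    modulus at z = t + ib is at most its value at t. Here (1 + (b/t)^2) is
    |z|^2/t^2. *)
Lemma onem_exp_le_ratio (R : realType) (t b y : R) : 0 < t -> 0 <= y ->
  (1 - expR (- (t * y)) * cos (b * y)) ^+ 2 +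
    (expR (- (t * y)) * sin (b * y)) ^+ 2 <=
  (1 + (b / t) ^+ 2) * (1 - expR (- (t * y))) ^+ 2.
Proof.
move=> t0 y0; rewrite sqr_norm_onem_exp [leRHS]mulrDl mul1r lerD2l.
have := sqr_mul_expRN_le (mulr_ge0 (ltW t0) y0).
have := onem_cos_le (b * y); have := expR_gt0 (- (t * y)).
set E := expR _ => E0 hc hE.
apply: (@le_trans _ _ ((b / t) ^+ 2 * ((t * y) ^+ 2 * E))); last first.
  by rewrite ler_wpM2l// sqr_ge0.
have -> : (b / t) ^+ 2 * ((t * y) ^+ 2 * E) = 2 * E * ((b * y) ^+ 2 / 2).
  by field; rewrite gt_eqF.
by rewrite ler_wpM2l// mulr_ge0// ltW.
Qed.

Lemma expRN8_le (R : realType) (u : R) : 8 <= u -> expR (- u) <= 1 / 256.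
Proof.
move=> u8; apply: (@le_trans _ _ (expR (- 8))); first by rewrite ler_expR lerN2.
have h : (expR 1)^-1 <= 1 / 2 :> R.
  rewrite div1r lef_pV2 ?posrE ?expR_gt0//.
  by have := expR_ge1Dx (1 : R); lra.
have -> : expR (- 8) = (expR 1)^-1 ^+ 8 :> R.
  by rewrite -expRN -expRM_natl mulrN1.
have -> : 1 / 256 = (1 / 2) ^+ 8 :> R by field.
by rewrite lerXn2r ?nnegrE ?invr_ge0 ?expR_ge0.
Qed.

(** For large jumps the numerators |1 - e^(-zy)| and 1 - e^(-ty) are both
    close to 1, while |z| exceeds t by a fixed factor when |b| is comparable
    to t. This is where the exponential decay of Gamma / W comes from. *)
Lemma onem_exp_lt_ratio (R : realType) (t b y : R) : 0 < t ->
  t ^+ 2 <= 9 * b ^+ 2 -> 8 <= t * y ->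
  (1 - expR (- (t * y)) * cos (b * y)) ^+ 2 +
    (expR (- (t * y)) * sin (b * y)) ^+ 2 <=
  (1 + (b / t) ^+ 2) * (49 / 50 * (1 - expR (- (t * y)))) ^+ 2.
Proof.
move=> t0 tb /expRN8_le; rewrite sqr_norm_onem_exp.
have := expR_gt0 (- (t * y)); set E := expR _ => E0 hE.
have hr : 1 / 9 <= (b / t) ^+ 2.
  by rewrite expr_div_n ler_pdivlMr ?exprn_gt0//; lra.
apply: (@le_trans _ _ ((1 + E) ^+ 2)).
  have := cos_geN1 (b * y); nra.
apply: (@le_trans _ _ ((10 / 9) * (49 / 50 * (1 - E)) ^+ 2)); last first.
  by rewrite ler_wpM2r ?sqr_ge0//; lra.
nra.
Qed.

(** The modulus |1 - e^(-zy)| is at most 2, and at most |z| y, where |z|^2 <=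
    2 w^2. *)
Lemma onem_exp_le_min (R : realType) (a w y : R) : 0 <= a -> a <= w -> 0 <= y ->
  (1 - expR (- (a * y)) * cos (w * y)) ^+ 2 +
    (expR (- (a * y)) * sin (w * y)) ^+ 2 <=
  (2 * Num.min (w * y) 1) ^+ 2.
Proof.
move=> a0 aw y0; rewrite sqr_norm_onem_exp.
have ay0 : 0 <= a * y by rewrite mulr_ge0.
have ay : a * y <= w * y by rewrite ler_wpM2r.
have E1 : expR (- (a * y)) <= 1 by rewrite expR_le1 oppr_le0.
have := expR_ge1Dx (- (a * y)).
have := expR_gt0 (- (a * y)); move: E1; set E := expR _ => E1 E0 hE.
have := onem_cos_le (w * y); have := cos_geN1 (w * y); have := cos_le1 (w * y).
move: ay ay0 hE; set v := w * y; set u := a * y; set c := cos v => uv u0 hE c1 cN1 hc.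
have h1 : (1 - E) ^+ 2 <= v ^+ 2 by rewrite lerXn2r ?nnegrE; lra.
have h2 : 2 * E * (1 - c) <= v ^+ 2 by nra.
have [v1|v1] := leP v 1; first by nra.
nra.
Qed.

Lemma kernel_norm_le (R : realType) (a b y : R) : 0 <= a -> 0 < y ->
  (1 - expR (- (a * y)) * cos (b * y)) ^+ 2 +
    (expR (- (a * y)) * sin (b * y)) ^+ 2 <=
  ((a + `|b| + 2) * Num.min y 1) ^+ 2.
Proof.
move=> a0 y0; rewrite sqr_norm_onem_exp.
have ay0 : 0 <= a * y by rewrite mulr_ge0// ltW.
have E1 : expR (- (a * y)) <= 1 by rewrite expR_le1 oppr_le0.
have := expR_ge1Dx (- (a * y)).
have := expR_gt0 (- (a * y)); move: E1; set E := expR _ => E1 E0 hE.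
have := onem_cos_le (b * y); have := cos_geN1 (b * y); have := cos_le1 (b * y).
set c := cos _ => c1 cN1 hc.
have b0 := normr_ge0 b.
have h1 : (1 - E) ^+ 2 <= (a * y) ^+ 2 by rewrite lerXn2r ?nnegrE; lra.
have h2 : 2 * E * (1 - c) <= (b * y) ^+ 2 by nra.
have bE : (b * y) ^+ 2 = (`|b| * y) ^+ 2 by rewrite !exprMn real_normK ?num_real.
have [y1|y1] := leP y 1.
  apply: (@le_trans _ _ ((a * y + `|b| * y) ^+ 2)).
    have : 0 <= (a * y) * (`|b| * y) by rewrite !mulr_ge0// ltW.
    by move: h2; rewrite bE; lra.
  by rewrite lerXn2r ?nnegrE; nra.
apply: (@le_trans _ _ (2 ^+ 2)); first by nra.
by rewrite lerXn2r ?nnegrE; nra.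
Qed.

(** First-order bound that makes the phase kernel nonnegative: its right-hand
    side is below w e^(ay). *)
Lemma sin_cos_comb_le (R : realType) (a w y : R) : 0 <= a -> 0 <= w -> 0 <= y ->
  a * sin (w * y) + w * cos (w * y) <= w * (1 + a * y).
Proof.
move=> a0 w0 y0.
have h1 : a * sin (w * y) <= a * (w * y) by rewrite ler_wpM2l// sin_le// mulr_ge0.
have h2 : w * cos (w * y) <= w * 1 by rewrite ler_wpM2l// cos_le1.
nra.
Qed.

(** The kernel is Im (z * conj (1 - e^(-zy))) at z = a + iw; it is nonnegative
    whatever the jump y, so the whole Levy measure pushes the argument of z /
    phi(z) in the same direction. *)
Lemma phase_kernel_ge0 (R : realType) (a w y : R) : 0 <= a -> 0 <= w -> 0 <= y ->
  0 <= w * (1 - expR (- (a * y)) * cos (w * y)) - a * (expR (- (a * y)) * sin (w * y)).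
Proof.
move=> a0 w0 y0; have := sin_cos_comb_le a0 w0 y0.
have := expR_ge1Dx (a * y); have := expR_gt0 (a * y).
rewrite expRN; set g := expR _ => g0 hg h.
have -> : w * (1 - g^-1 * cos (w * y)) - a * (g^-1 * sin (w * y)) =
  (w * g - (a * sin (w * y) + w * cos (w * y))) / g by field; rewrite gt_eqF.
rewrite divr_ge0 ?(ltW g0)// subr_ge0 (le_trans h)//; nra.
Qed.

(** Multiplying by e^(ay) leaves w (e^(ay) - cos) - a sin, and e^(ay) - 1
    absorbs the sine term; what remains is w (1 - cos (wy)). The upper bound 2
    on wy keeps clear of 2 pi, where this vanishes. *)
Lemma phase_kernel_lb (R : realType) (a w y : R) : 0 <= a -> a <= w ->
  1 <= w * y -> w * y <= 2 ->
  w * (expR (- 2) * (1 - cos 1)) <=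
  w * (1 - expR (- (a * y)) * cos (w * y)) - a * (expR (- (a * y)) * sin (w * y)).
Proof.
move=> a0 aw v1 v2.
have w0 : 0 <= w by exact: le_trans aw.
have y0 : 0 <= y by rewrite leNgt; apply/negP => y0; nra.
have ay : a * y <= w * y by rewrite ler_wpM2r.
have hcos : cos (w * y) <= cos 1.
  have pi2 := @pi_ge2 R.
  move: v1; rewrite le_eqVlt => /predU1P[<-//|v1].
  by apply: ltW; rewrite ltr_cos// in_itv/=; lra.
have cos11 : 0 <= 1 - cos 1 :> R by rewrite subr_ge0 cos_le1.
have hs : a * sin (w * y) <= a * (w * y) by rewrite ler_wpM2l// sin_le// mulr_ge0.
have e2 : expR (- 2) <= expR (- (a * y)) by rewrite ler_expR lerN2; lra.
have := expR_ge1Dx (a * y); have := expR_gt0 (a * y); move: e2.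
rewrite [expR (- (a * y))]expRN; set g := expR (a * y) => e2 g0 hg.
have -> : w * (1 - g^-1 * cos (w * y)) - a * (g^-1 * sin (w * y)) =
  (w * g - (a * sin (w * y) + w * cos (w * y))) * g^-1 by field; rewrite gt_eqF.
rewrite mulrA [w * _]mulrC -mulrA [leRHS]mulrC ler_pM ?expR_ge0// ?mulr_ge0//.
nra.
Qed.

(** Near u = 1 the logarithm is at most 2 |u - 1|; away from 1 the left-hand
    side is at most 2, which is where the constant 8 comes from. It converts a
    variance bound on u into a bound on the oscillation of u^(ib). *)
Lemma onem_cos_ln_le (R : realType) (b u : R) : 0 < u ->
  1 - cos (b * ln u) <= (2 * b ^+ 2 + 8) * (u - 1) ^+ 2.
Proof.
move=> u0; have b2 := sqr_ge0 b; have s2 := sqr_ge0 (u - 1).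
have [uh|uh] := leP (u - 1) (- (1 / 2)).
  have : 1 / 4 <= (u - 1) ^+ 2 by nra.
  have := cos_geN1 (b * ln u); nra.
have [uh'|uh'] := leP (1 / 2) (u - 1).
  have : 1 / 4 <= (u - 1) ^+ 2 by nra.
  have := cos_geN1 (b * ln u); nra.
have hl : ln u ^+ 2 <= 4 * (u - 1) ^+ 2.
  have l1 : ln u <= u - 1.
    have -> : ln u = ln (1 + (u - 1)) by congr ln; ring.
    by apply: le_ln1Dx; lra.
  have l2 : - ln u <= u^-1 - 1.
    rewrite -lnV ?posrE//.
    have {1}-> : u^-1 = 1 + (u^-1 - 1) by ring.
    by apply: le_ln1Dx; have := u0; rewrite -invr_gt0; lra.
  have [ug|ug] := leP 1 u.
    by have := ln_ge0 ug; nra.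
  have l3 : u^-1 - 1 <= 2 * (1 - u).
    have -> : u^-1 - 1 = (1 - u) / u by field; rewrite gt_eqF.
    by rewrite ler_pdivrMr//; nra.
  have l0 := ln_le0 (ltW ug); nra.
apply: le_trans (onem_cos_le _) _; rewrite exprMn; nra.
Qed.

(** * Modulus and principal argument *)

Lemma normc_pairE (R : realType) (x y : R) :
  Normc.normc (x +i* y) = Num.sqrt (x ^+ 2 + y ^+ 2).
Proof. by []. Qed.

Lemma normc_ge0 (R : realType) (z : R[i]) : 0 <= Normc.normc z.
Proof. by case: z => x y; rewrite normc_pairE sqrtr_ge0. Qed.

Lemma normc_sqr (R : realType) (z : R[i]) :
  Normc.normc z ^+ 2 = complex.Re z ^+ 2 + complex.Im z ^+ 2.
Proof. by case: z => x y; rewrite normc_pairE sqr_sqrtr// addr_ge0 ?sqr_ge0. Qed.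

Lemma normc_le (R : realType) (z : R[i]) (r : R) : 0 <= r ->
  complex.Re z ^+ 2 + complex.Im z ^+ 2 <= r ^+ 2 -> Normc.normc z <= r.
Proof.
move=> r0 h; rewrite -(@ler_pXn2r _ 2)// ?nnegrE ?normc_ge0//.
by rewrite normc_sqr.
Qed.

Lemma normc_polar (R : realType) (t b : R) : 0 < t ->
  Normc.normc (t +i* b) = t * Num.sqrt (1 + (b / t) ^+ 2).
Proof.
move=> t0; rewrite normc_pairE.
have -> : t ^+ 2 + b ^+ 2 = t ^+ 2 * (1 + (b / t) ^+ 2) by field; rewrite gt_eqF.
by rewrite sqrtrM ?sqr_ge0// sqrtr_sqr gtr0_norm.
Qed.

(** The imaginary part shows that the argument of z / phi(z) has the sign of w
    Re phi - a Im phi. *)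
Lemma div_complexE (R : realType) (a w P Q : R) : 0 < P ->
  (a +i* w) / (P +i* Q) =
  ((a * P + w * Q) / (P ^+ 2 + Q ^+ 2)) +i* ((w * P - a * Q) / (P ^+ 2 + Q ^+ 2)).
Proof.
move=> P0; have n0 : P ^+ 2 + Q ^+ 2 != 0.
  by rewrite gt_eqF// ltr_pwDl ?exprn_gt0// sqr_ge0.
apply/eqP; rewrite eq_complex /=; apply/andP; split; apply/eqP; field => //.
Qed.

Lemma normc_real (R : realType) (x : R) : 0 <= x -> Normc.normc (x +i* 0) = x.
Proof.
by move=> x0; rewrite normc_pairE expr0n addr0 sqrtr_sqr ger0_norm.
Qed.

Lemma Re_normc_itv (R : realType) (z : R[i]) : -1 <= complex.Re z / Normc.normc z <= 1.
Proof.
rewrite -ler_norml normrM normfV [`|Normc.normc z|]ger0_norm ?normc_ge0//.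
have := normc_ge0 z; rewrite le_eqVlt => /predU1P[<-|n0].
  by rewrite invr0 mulr0.
rewrite ler_pdivrMr// mul1r -(@ler_pXn2r _ 2)// ?nnegrE ?normc_ge0//.
by rewrite real_normK ?num_real// normc_sqr lerDl sqr_ge0.
Qed.

Lemma carg_le_pi (R : realType) (z : R[i]) : `|carg z| <= pi.
Proof.
have zi := Re_normc_itv z.
rewrite /carg; case: ifP => _; rewrite ?normrN ger0_norm ?acos_ge0 ?acos_lepi//.
Qed.

(** The angle t = acos (Re z / |z|) satisfies t >= sin t = |Im z| / |z|. *)
Lemma acos_Re_ge (R : realType) (z : R[i]) (r : R) : 0 < Normc.normc z ->
  r * Normc.normc z <= `|complex.Im z| -> r <= acos (complex.Re z / Normc.normc z).
Proof.
move=> n0 h; have zi := Re_normc_itv z.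
apply: le_trans (sin_le (acos_ge0 zi)); rewrite sin_acos//.
have -> : 1 - (complex.Re z / Normc.normc z) ^+ 2 =
    (`|complex.Im z| / Normc.normc z) ^+ 2.
  apply/eqP; rewrite subr_eq !expr_div_n real_normK ?num_real// -mulrDl addrC.
  by rewrite -normc_sqr divff// expf_neq0// gt_eqF.
by rewrite sqrtr_sqr ger0_norm ?divr_ge0 ?normr_ge0 ?normc_ge0// ler_pdivlMr.
Qed.

Lemma carg_ge (R : realType) (z : R[i]) (r : R) : 0 < Normc.normc z ->
  0 <= complex.Im z -> r * Normc.normc z <= complex.Im z -> r <= carg z.
Proof.
by move=> n0 i0 h; rewrite /carg i0; apply: acos_Re_ge; rewrite ?ger0_norm.
Qed.

Lemma carg_ge0 (R : realType) (z : R[i]) : 0 <= complex.Im z -> 0 <= carg z.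
Proof. by move=> i0; rewrite /carg i0 acos_ge0// Re_normc_itv. Qed.

(** Conjugation reverses the principal argument except on the negative real
    axis, which the hypothesis excludes. *)
Lemma carg_conj (R : realType) (x y : R) : 0 < y \/ 0 < x ->
  carg (x -i* y) = - carg (x +i* y).
Proof.
have nE : Normc.normc (x -i* y) = Normc.normc (x +i* y).
  by rewrite !normc_pairE sqrrN.
rewrite /carg nE/= oppr_ge0.
have [y0|y0|<-] := ltgtP 0 y => //.
  by rewrite opprK.
case=> // x0.
by rewrite expr0n addr0 sqrtr_sqr gtr0_norm// divff ?gt_eqF// acos1 oppr0.
Qed.

(** * Bounds on integrals *)

(** The modulus of a complex integral is at most the integral of the modulus.
    With X, Z the two integrals and N = (X^2 + Z^2)^(1/2), integrate X f + Z g
    <= N h and divide by N. *)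
Lemma Rintegral_norm2_le d (T : measurableType d) (R : realType)
    (mu : {measure set T -> \bar R}) (D : set T) (f g h : T -> R) :
  measurable D -> mu.-integrable D (EFin \o f) -> mu.-integrable D (EFin \o g) ->
  mu.-integrable D (EFin \o h) -> (forall x, D x -> 0 <= h x) ->
  (forall x, D x -> f x ^+ 2 + g x ^+ 2 <= h x ^+ 2) ->
  (\int[mu]_(x in D) f x) ^+ 2 + (\int[mu]_(x in D) g x) ^+ 2 <=
  (\int[mu]_(x in D) h x) ^+ 2.
Proof.
move=> mD fi gi hi h0 fgh.
set X := \int[mu]_(x in D) f x; set Y := \int[mu]_(x in D) g x.
set H := \int[mu]_(x in D) h x.
have N20 : 0 <= X ^+ 2 + Y ^+ 2 by rewrite addr_ge0 ?sqr_ge0.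
pose N := Num.sqrt (X ^+ 2 + Y ^+ 2).
have NE : N ^+ 2 = X ^+ 2 + Y ^+ 2 by rewrite sqr_sqrtr.
have N0 : 0 <= N by exact: sqrtr_ge0.
have H0 : 0 <= H by exact: Rintegral_ge0.
have Zi c (k : T -> R) : mu.-integrable D (EFin \o k) ->
    mu.-integrable D (EFin \o (fun x => c * k x)).
  by move=> ki; exact: (integrableZl mD c ki).
have NNH : N ^+ 2 <= N * H.
  rewrite NE !expr2 -!RintegralZl// -RintegralD//; [|exact: Zi|exact: Zi].
  apply: le_Rintegral => //.
  - by apply: (integrableD mD (Zi _ _ fi) (Zi _ _ gi)).
  - exact: Zi.
  - move=> x Dx; have := fgh x Dx; have := h0 x Dx.
    move: (f x) (g x) (h x) => p q r r0 pqr.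
    have : (X * p + Y * q) ^+ 2 <= (N * r) ^+ 2.
      rewrite exprMn NE; apply: (@le_trans _ _ ((X ^+ 2 + Y ^+ 2) * (p ^+ 2 + q ^+ 2))).
        have := sqr_ge0 (X * q - Y * p); lra.
      by rewrite ler_wpM2l.
    have [s0|s0] := leP 0 (X * p + Y * q).
      by rewrite ler_pXn2r// nnegrE mulr_ge0.
    by move=> _; apply: le_trans (ltW s0) _; rewrite mulr_ge0.
rewrite -NE; have [->|Nn0] := eqVneq N 0; first by rewrite expr0n sqr_ge0.
have : N <= H by rewrite -(@ler_pM2l _ N) -?expr2// lt_neqAle eq_sym Nn0.
by rewrite ler_pXn2r// nnegrE.
Qed.

(** The integral of a nonnegative function is the supremum of the integrals of
    the simple functions below it, hence monotone for arbitrary functions. In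
    this form it applies directly to the argument function w |-> arg (z /
    phi(z)). *)
Lemma ge0_integral_mono d (T : measurableType d) (R : realType)
    (mu : {measure set T -> \bar R}) (D : set T) (f g : T -> \bar R) :
  (forall x, D x -> 0 <= f x)%E -> (forall x, D x -> f x <= g x)%E ->
  (\int[mu]_(x in D) f x <= \int[mu]_(x in D) g x)%E.
Proof.
move=> f0 fg; rewrite !(integral_mkcond D).
have h12 x : (f \_ D x <= g \_ D x)%E by apply: lee_restrict.
have h10 x : (0 <= f \_ D x)%E by apply: erestrict_ge0.
rewrite !ge0_integralTE//; last by move=> x; exact: le_trans (h12 x).
apply: ereal_sup_le => _ [h /= hf <-].
by exists h => //= x; exact: le_trans (hf x) (h12 x).
Qed.

Lemma Rintegral_itv_ge (R : realType) (f : R -> R) (u v c d e M : R) :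
  u <= c -> c <= d -> d <= v -> 0 <= e -> (forall w, u <= w <= v -> 0 <= f w <= M) ->
  (forall w, c <= w <= d -> e <= f w) ->
  e * (d - c) <= \int[lebesgue_measure]_(w in `[u, v]) f w.
Proof.
move=> uc cd dv e0 fM fe.
have cuv : (`[c, d] `<=` `[u, v])%classic by apply: subset_itv; rewrite bnd_simp.
rewrite -lee_fin /Rintegral fineK; last first.
  rewrite ge0_fin_numE; last first.
    by apply: integral_ge0 => w /=; rewrite in_itv/= => /fM/andP[]; rewrite lee_fin.
  apply: (@le_lt_trans _ _ (\int[lebesgue_measure]_(w in `[u, v]) M%:E)%E).
    by apply: ge0_integral_mono => w /=; rewrite in_itv/= => /fM/andP[]; rewrite !lee_fin.
  rewrite integral_cst//= lebesgue_measure_itv/=; case: ifP => _.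
    by rewrite -EFinB -EFinM ltry.
  by rewrite mule0 ltry.
apply: (@le_trans _ _ (\int[lebesgue_measure]_(w in `[u, v])
    (e%:E * (\1_(`[c, d]%classic) w)%:E))%E).
  rewrite ge0_integralZl//; last first.
    by apply/measurable_EFinP; apply: measurable_indic; exact: measurable_itv.
  rewrite integral_indic//= setIidl// lebesgue_measure_itv/= lte_fin.
  rewrite EFinM lee_wpmul2l ?lee_fin//.
  move: cd; rewrite le_eqVlt => /predU1P[->|cd]; first by rewrite subrr ltxx.
  by rewrite cd EFinB.
apply: ge0_integral_mono => w wuv; first by rewrite mule_ge0 ?lee_fin.
rewrite indicE; case: (boolP (w \in `[c, d]%classic)) => wcd.
  by rewrite mule1 lee_fin; apply: fe; move: wcd; rewrite inE/= in_itv.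
by rewrite mule0 lee_fin; move: wuv; rewrite /= in_itv/= => /fM/andP[].
Qed.

Lemma indic_itv_gt (R : realType) (x y : R) :
  (\1_(`]x, +oo[%classic : set R) y : R) = ((x < y)%R)%:R.
Proof.
rewrite indicE; congr (nat_of_bool _)%:R; apply/idP/idP; rewrite inE/= in_itv/= andbT//.
Qed.

(** * Levy measures and their tails *)

Section levy.
Context (R : realType) (mu : {measure set (measurableTypeR R) -> \bar R}).
Local Notation D := (`]0%R, +oo[%classic : set (measurableTypeR R)).
Implicit Types f g : R -> R.

(** By Tonelli this is the integral over ]0, x] of the tail of mu, that is,
    the integrated tail expressed through mu itself. *)
Definition levy_min (x : R) : R := \int[mu]_(y in D) Num.min y x.
Definition phi_re (a b : R) : R :=
  \int[mu]_(y in D) (1 - expR (- (a * y)) * cos (b * y)).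
Definition phi_im (a b : R) : R :=
  \int[mu]_(y in D) (expR (- (a * y)) * sin (b * y)).

Lemma measurable_half_line : measurable D.
Proof. exact: measurable_itv. Qed.

Lemma half_lineP (y : R) : D y -> 0 < y.
Proof. by rewrite /= in_itv/= andbT. Qed.

(** Splits the exponent into real functions, on which all the estimates are
    made. *)
Lemma laplace_exponentE (q a b : R) :
  laplace_exponent q 0 mu (a +i* b) = (q + phi_re a b) +i* phi_im a b.
Proof.
rewrite /laplace_exponent /cintegral /phi_re /phi_im.
rewrite (_ : 0%:C * (a +i* b) = 0); last by rewrite mul0r.
rewrite addr0; apply/eqP; rewrite eq_complex /=; apply/andP; split; apply/eqP.
  congr (_ + _); apply: eq_Rintegral => y _ /=.
  by rewrite !mulr0 oppr0 addr0 add0r !mulNr cosN.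
rewrite add0r; apply: eq_Rintegral => y _ /=.
by rewrite !mulr0 oppr0 addr0 !add0r !mulNr sinN mulrN opprK.
Qed.

Lemma continuous_measurable_half_line f : continuous f -> measurable_fun D f.
Proof.
by move=> cf; apply: (@measurable_funS _ _ _ _ setT) => //; exact: continuous_measurable_fun.
Qed.

Lemma continuous_kernel_cos (a b : R) :
  continuous (fun y : R => expR (- (a * y)) * cos (b * y)).
Proof.
move=> y; apply: cvgM.
  apply: continuous_comp; last exact: continuous_expR.
  by apply: cvgN; apply: cvgM; [exact: cvg_cst|exact: cvg_id].
apply: continuous_comp; last exact: continuous_cos.
by apply: cvgM; [exact: cvg_cst|exact: cvg_id].
Qed.

Lemma continuous_kernel_sin (a b : R) :
  continuous (fun y : R => expR (- (a * y)) * sin (b * y)).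
Proof.
move=> y; apply: cvgM.
  apply: continuous_comp; last exact: continuous_expR.
  by apply: cvgN; apply: cvgM; [exact: cvg_cst|exact: cvg_id].
apply: continuous_comp; last exact: continuous_sin.
by apply: cvgM; [exact: cvg_cst|exact: cvg_id].
Qed.

Context (hmu : levy_measure mu).

Lemma levy_integrable_min1 : mu.-integrable D (EFin \o (fun y : R => Num.min y 1)).
Proof.
apply/integrableP; split.
  apply/measurable_EFinP; apply: measurable_minr => //.
case: hmu => _; apply: le_lt_trans.
rewrite le_eqVlt; apply/orP; left; apply/eqP; apply: eq_integral => y.
by rewrite inE => /half_lineP y0 /=; rewrite ger0_norm// le_min ltW//=.
Qed.

Lemma levy_integrable f (K : R) : measurable_fun D f ->
  (forall y, 0 < y -> `|f y| <= K * Num.min y 1) -> mu.-integrable D (EFin \o f).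
Proof.
move=> mf fK; have i1 := integrableZl measurable_half_line K levy_integrable_min1.
apply: (le_integrable measurable_half_line _ _ i1).
  exact/measurable_EFinP.
move=> y /half_lineP y0 /=; rewrite lee_fin (le_trans (fK y y0))//.
by rewrite ler_norm.
Qed.

Lemma levy_integrable_min (x : R) : 0 < x ->
  mu.-integrable D (EFin \o (fun y : R => Num.min y x)).
Proof.
move=> x0; apply: (@levy_integrable _ (Num.max x 1)).
  by apply: measurable_minr.
move=> y y0; rewrite ger0_norm; last by rewrite le_min !ltW.
have [yx|xy] := leP y x; have [y1|y1] := leP y 1.
- have : 1 <= Num.max x 1 by rewrite le_max lexx orbT.
  nra.
- by rewrite mulr1 le_max yx.
- have : x <= Num.max x 1 by rewrite le_max lexx.
  have : 1 <= Num.max x 1 by rewrite le_max lexx orbT.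
  nra.
- by rewrite mulr1 le_max lexx.
Qed.

Lemma levy_tail_fin (x : R) : 0 < x -> (mu `]x, +oo[%classic < +oo)%E.
Proof.
move=> x0.
have mB : measurable (`]x, +oo[%classic : set (measurableTypeR R)) by exact: measurable_itv.
have hB : (x%:E * mu `]x, +oo[%classic < +oo)%E.
  rewrite -integral_cst//.
  have /integrableP[_] := levy_integrable_min x0.
  apply: le_lt_trans.
  apply: (@le_trans _ _ (\int[mu]_(y in `]x, +oo[) `|(Num.min y x)%:E|)%E).
    apply: ge0_integral_mono => //= y; first by rewrite lee_fin ltW.
    rewrite in_itv/= andbT => xy; rewrite lee_fin ger0_norm ?le_min ?lexx ?ltW//.
    exact: lt_trans xy.
  apply: ge0_subset_integral => //.
  - apply/measurable_EFinP; apply: measurableT_comp => //.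
    by apply: measurable_minr.
  - by apply: subset_itvr; rewrite bnd_simp ltW.
rewrite ltey; apply/eqP => muoo; move: hB; rewrite muoo gt0_muley ?lte_fin//.
Qed.

Lemma levy_tailE (x : R) : 0 < x -> (levy_tail mu x)%:E = mu `]x, +oo[%classic.
Proof. by move=> x0; rewrite /levy_tail fineK// ge0_fin_numE// levy_tail_fin. Qed.

Lemma levy_tail_ge0 (x : R) : 0 <= levy_tail mu x.
Proof. by rewrite /levy_tail fine_ge0. Qed.

Lemma levy_tail_nonincreasing (x y : R) : 0 < x -> x <= y ->
  levy_tail mu y <= levy_tail mu x.
Proof.
move=> x0 xy; rewrite -lee_fin !levy_tailE ?(lt_le_trans x0)//.
apply: le_measure; rewrite ?inE; try exact: measurable_itv.
by apply: subset_itvr; rewrite bnd_simp.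
Qed.

Lemma levy_indic_integrable (x : R) : 0 < x ->
  mu.-integrable D (EFin \o (\1_(`]x, +oo[%classic) : R -> R)).
Proof.
move=> x0; apply/integrableP; split.
  by apply/measurable_EFinP; apply: measurable_indic; exact: measurable_itv.
have := levy_tail_fin x0; apply: le_lt_trans.
under eq_integral do rewrite /= ger0_norm//.
rewrite integral_indic//.
apply: le_measure; rewrite ?inE; [|exact: measurable_itv|exact: subIsetl].
by apply: measurableI; exact: measurable_itv.
Qed.

Lemma levy_integral_indic (x : R) : 0 < x ->
  \int[mu]_(y in D) (\1_`]x, +oo[%classic y : R) = levy_tail mu x.
Proof.
move=> x0; rewrite /Rintegral integral_indic; [|exact: measurable_itv..].
rewrite /levy_tail setIidl//.
by apply: subset_itvr; rewrite bnd_simp ltW.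
Qed.

(** Only the jumps larger than x contribute to the increment, each by at most
    x. *)
Lemma levy_min_sub (x : R) : 0 < x ->
  levy_min (2 * x) - levy_min x <= x * levy_tail mu x.
Proof.
move=> x0; have x20 : 0 < 2 * x by lra.
rewrite /levy_min -RintegralB; [|exact: measurable_half_line|exact: levy_integrable_min..].
rewrite -levy_integral_indic// -RintegralZl;
  [|exact: measurable_half_line|exact: levy_indic_integrable].
apply: le_Rintegral.
- exact: measurable_half_line.
- exact: (integrableB measurable_half_line
    (levy_integrable_min x20) (levy_integrable_min x0)).
- exact: (integrableZl measurable_half_line x (levy_indic_integrable x0)).
move=> y /half_lineP y0; rewrite indicE.
case: (boolP (y \in `]x, +oo[%classic)) => yx.
  rewrite /= mulr1; move: yx; rewrite inE/= in_itv/= andbT => yx.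
  rewrite [Num.min y x]min_r ?(ltW yx)//.
  have : Num.min y (2 * x) <= 2 * x by rewrite ge_min lexx orbT.
  lra.
rewrite mulr0; have yx' : y <= x.
  by move: yx; rewrite notin_setE/= in_itv/= andbT => /negP; rewrite -leNgt.
rewrite !min_l ?subrr//; lra.
Qed.

Lemma levy_min_ge0 (x : R) : 0 <= x -> 0 <= levy_min x.
Proof. by move=> x0; apply: Rintegral_ge0 => y /half_lineP y0; rewrite le_min ltW. Qed.

Lemma levy_min_cvg0 (x : R) : 0 < x -> levy_min (x / 2 ^+ n) @[n --> \oo] --> 0.
Proof.
move=> x0.
have xn0 n : 0 < x / 2 ^+ n by rewrite divr_gt0// exprn_gt0.
have xnx n : x / 2 ^+ n <= x.
  by rewrite ler_pdivrMr ?exprn_gt0// ler_peMr ?(ltW x0)// exprn_ege1//; lra.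
have cv : (fun n => x / 2 ^+ n) @ \oo --> (0 : R).
  rewrite -(mulr0 x); apply: cvgM; first exact: cvg_cst.
  rewrite (_ : (fun _ => _) = (fun n => (2^-1 : R) ^+ n)); last by apply/funext => n; rewrite exprVn.
  by apply: cvg_expr; rewrite ger0_norm; lra.
have [|||||] := @dominated_convergence _ _ R mu D measurable_half_line
  (fun n y => (Num.min y (x / 2 ^+ n))%:E) (cst 0%E) (fun y => (Num.min y x)%:E).
- by move=> n; apply/measurable_EFinP; apply: measurable_minr.
- exact: measurable_cst.
- apply: aeW => y /half_lineP y0; apply: cvg_EFin; first by near=> n.
  apply: (@squeeze_cvgr _ _ _ _ (cst 0) (fun n => x / 2 ^+ n)) => //; last exact: cvg_cst.
  by near=> n; rewrite /= le_min ge_min lexx orbT !ltW.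
- exact: levy_integrable_min.
- apply: aeW => y n /half_lineP y0; rewrite lee_fin ger0_norm ?le_min ?(ltW y0) ?(ltW (xn0 n))//.
  by rewrite ge_min lexx/= ge_min xnx orbT.
move=> _ _; rewrite integral0 => /fine_cvgP[_].
exact.
Unshelve. all: end_near.
Qed.
End levy.

(** * The driftless Laplace exponent *)

Section exponent.
Context (R : realType) (mu : {measure set (measurableTypeR R) -> \bar R}).
Context (hmu : levy_measure mu).
Local Notation D := (`]0%R, +oo[%classic : set (measurableTypeR R)).
Local Notation mD := (@measurable_half_line R).

Lemma phi_re_integrable (a b : R) : 0 <= a ->
  mu.-integrable D (EFin \o (fun y : R => 1 - expR (- (a * y)) * cos (b * y))).
Proof.
move=> a0; apply: (levy_integrable hmu (K := a + `|b| + 2)).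
  apply: measurable_funB; first exact: measurable_cst.
  exact: continuous_measurable_half_line (@continuous_kernel_cos R a b).
move=> y y0; have k0 : 0 <= (a + `|b| + 2) * Num.min y 1.
  by rewrite mulr_ge0 ?addr_ge0// le_min !ltW.
rewrite -(@ler_pXn2r _ 2)// ?nnegrE// real_normK ?num_real//.
by apply: le_trans (kernel_norm_le b a0 y0); rewrite lerDl sqr_ge0.
Qed.

Lemma phi_im_integrable (a b : R) : 0 <= a ->
  mu.-integrable D (EFin \o (fun y : R => expR (- (a * y)) * sin (b * y))).
Proof.
move=> a0; apply: (levy_integrable hmu (K := a + `|b| + 2)).
  exact: continuous_measurable_half_line (@continuous_kernel_sin R a b).
move=> y y0; have k0 : 0 <= (a + `|b| + 2) * Num.min y 1.
  by rewrite mulr_ge0 ?addr_ge0// le_min !ltW.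
rewrite -(@ler_pXn2r _ 2)// ?nnegrE// real_normK ?num_real//.
by apply: le_trans (kernel_norm_le b a0 y0); rewrite lerDr sqr_ge0.
Qed.

Lemma phi_re0E (a : R) : phi_re mu a 0 = \int[mu]_(y in D) (1 - expR (- (a * y))).
Proof. by apply: eq_Rintegral => y _; rewrite mul0r cos0 mulr1. Qed.

Lemma phi_re0_integrable (a : R) : 0 <= a ->
  mu.-integrable D (EFin \o (fun y : R => 1 - expR (- (a * y)))).
Proof.
move=> a0; apply: eq_integrable (phi_re_integrable 0 a0); first exact: mD.
by move=> y _ /=; rewrite mul0r cos0 mulr1.
Qed.

Lemma phi_im0 (a : R) : phi_im mu a 0 = 0.
Proof.
rewrite /phi_im (@eq_Rintegral _ _ _ _ _ (cst 0)); last first.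
  by move=> y _; rewrite mul0r sin0 mulr0.
by rewrite Rintegral_cst ?mul0r//; exact: mD.
Qed.

Lemma phi_reN (a b : R) : phi_re mu a (- b) = phi_re mu a b.
Proof. by apply: eq_Rintegral => y _; rewrite mulNr cosN. Qed.

Lemma phi_imN (a b : R) : 0 <= a -> phi_im mu a (- b) = - phi_im mu a b.
Proof.
move=> a0; rewrite -[RHS]mulN1r -RintegralZl; [|exact: mD|exact: phi_im_integrable].
by apply: eq_Rintegral => y _; rewrite mulNr sinN mulrN mulN1r.
Qed.

Lemma phi_re0_le (a b : R) : 0 <= a -> phi_re mu a 0 <= phi_re mu a b.
Proof.
move=> a0; apply: le_Rintegral; [exact: mD|exact: phi_re_integrable..|].
move=> y _; rewrite mul0r cos0 mulr1 lerD2l lerN2.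
by rewrite -[leRHS]mulr1 ler_wpM2l ?expR_ge0// cos_le1.
Qed.

Lemma le_tail_Rintegral (f : R -> R) (c x : R) : 0 < x ->
  mu.-integrable D (EFin \o f) -> (forall y, 0 < y -> 0 <= f y) ->
  (forall y, x < y -> c <= f y) -> c * levy_tail mu x <= \int[mu]_(y in D) f y.
Proof.
move=> x0 fi f0 fc.
rewrite -levy_integral_indic// -RintegralZl; [|exact: mD|exact: levy_indic_integrable].
apply: le_Rintegral => //.
- exact: (integrableZl mD c (levy_indic_integrable hmu x0)).
move=> y /half_lineP y0; rewrite indicE.
case: (boolP (y \in `]x, +oo[%classic)) => yx.
  by rewrite mulr1 fc//; move: yx; rewrite inE/= in_itv/= andbT.
by rewrite mulr0 f0.
Qed.

(** Jumps larger than x each contribute at least 1 - e^(-ax). *)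
Lemma phi_re0_ge (a x : R) : 0 < a -> 0 < x ->
  (1 - expR (- (a * x))) * levy_tail mu x <= phi_re mu a 0.
Proof.
move=> a0 x0; rewrite phi_re0E; apply: le_tail_Rintegral => //.
- by apply: phi_re0_integrable; exact: ltW.
- by move=> y y0; rewrite subr_ge0 expR_le1 oppr_le0 mulr_ge0// ltW.
- by move=> y xy; rewrite lerD2l lerN2 ler_expR lerN2 ler_pM2l// ltW.
Qed.

Lemma phi_re0_le_min (a x : R) : 0 < a -> a^-1 <= x ->
  phi_re mu a 0 <= a * levy_min mu x.
Proof.
move=> a0 ax; have x0 : 0 < x by rewrite (lt_le_trans _ ax)// invr_gt0.
rewrite phi_re0E /levy_min -RintegralZl; [|exact: mD|exact: levy_integrable_min].
apply: le_Rintegral; first exact: mD.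
- by apply: phi_re0_integrable; exact: ltW.
- exact: (integrableZl mD a (levy_integrable_min hmu x0)).
move=> y /half_lineP y0.
have h1 : 1 - expR (- (a * y)) <= a * y by have := expR_ge1Dx (- (a * y)); lra.
have h2 : 1 - expR (- (a * y)) <= a * x.
  apply: (@le_trans _ _ 1); first by have := expR_gt0 (- (a * y)); lra.
  by rewrite -(@ler_pM2l _ a) ?mulfV ?gt_eqF in ax.
by have [] := leP y x.
Qed.

(** The function phi(t)/t is nonincreasing; this controls the variance of the
    tilted variable in the lower bound on W. *)
Lemma phi_re0_succ (t : R) : 0 < t ->
  phi_re mu (t + 1) 0 <= (1 + t^-1) * phi_re mu t 0.
Proof.
move=> t0; have t10 : 0 <= t + 1 by lra.
rewrite !phi_re0E -RintegralZl; [|exact: mD|exact/phi_re0_integrable/ltW].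
apply: le_Rintegral; first exact: mD.
- exact: phi_re0_integrable.
- exact: (integrableZl mD _ (phi_re0_integrable (ltW t0))).
move=> y /half_lineP y0; rewrite mulrDl mul1r opprD expRD expRN.
have := expR_ge1Dx (t * y); have := expR_gt0 (t * y); set g := expR (t * y) => g0 hg.
have := expR_ge1Dx (- y); set e := expR (- y) => he.
rewrite -subr_ge0.
have -> : (1 + t^-1) * (1 - g^-1) - (1 - g^-1 * e) =
  ((g - 1) - t * (1 - e)) / (t * g) by field; rewrite !gt_eqF.
by rewrite divr_ge0 ?mulr_ge0 ?(ltW t0) ?(ltW g0)//; nra.
Qed.

Lemma phi_norm_le (t b : R) : 0 < t ->
  phi_re mu t b ^+ 2 + phi_im mu t b ^+ 2 <=
  (1 + (b / t) ^+ 2) * phi_re mu t 0 ^+ 2.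
Proof.
move=> t0; have s0 : 0 <= 1 + (b / t) ^+ 2 by rewrite addr_ge0// sqr_ge0.
rewrite -[X in X * _](sqr_sqrtr s0) -exprMn phi_re0E -RintegralZl; first last.
  by apply: phi_re0_integrable; exact: ltW.
  exact: mD.
apply: Rintegral_norm2_le.
- exact: mD.
- by apply: phi_re_integrable; exact: ltW.
- by apply: phi_im_integrable; exact: ltW.
- exact: (integrableZl mD _ (phi_re0_integrable (ltW t0))).
- move=> y /half_lineP y0; rewrite mulr_ge0 ?sqrtr_ge0//.
  by rewrite subr_ge0 expR_le1 oppr_le0 mulr_ge0// ltW.
- by move=> y /half_lineP y0; rewrite [leRHS]exprMn sqr_sqrtr// onem_exp_le_ratio// ltW.
Qed.

(** The gain of a factor 49/50 on the jumps larger than x is recorded as the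
    subtraction of a multiple of the tail. *)
Lemma phi_norm_lt (t b x : R) : 0 < t -> 0 < x -> t ^+ 2 <= 9 * b ^+ 2 -> 8 <= t * x ->
  phi_re mu t b ^+ 2 + phi_im mu t b ^+ 2 <=
  (1 + (b / t) ^+ 2) * (phi_re mu t 0 - 1 / 100 * levy_tail mu x) ^+ 2.
Proof.
move=> t0 x0 tb tx; have s0 : 0 <= 1 + (b / t) ^+ 2 by rewrite addr_ge0// sqr_ge0.
have i1 := phi_re0_integrable (ltW t0).
have i2 := integrableZl mD (1 / 100) (levy_indic_integrable hmu x0).
have i3 := integrableB mD i1 i2.
rewrite -[X in X * _](sqr_sqrtr s0) -exprMn phi_re0E.
rewrite -levy_integral_indic// -RintegralZl; [|exact: mD|exact: levy_indic_integrable].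
rewrite -RintegralB// -RintegralZl//.
have kpos y : 0 < y -> 0 <= 1 - expR (- (t * y)) - 1 / 100 * \1_(`]x, +oo[%classic) y.
  move=> y0; rewrite indicE.
  case: (boolP (y \in `]x, +oo[%classic)) => yx; last first.
    by rewrite mulr0 subr0 subr_ge0 expR_le1 oppr_le0 mulr_ge0// ltW.
  have {}yx : x < y by move: yx; rewrite inE/= in_itv/= andbT.
  have : expR (- (t * y)) <= 1 / 256.
    by apply: expRN8_le; rewrite (le_trans tx)// ler_pM2l// ltW.
  by rewrite mulr1; lra.
apply: Rintegral_norm2_le.
- exact: mD.
- by apply: phi_re_integrable; exact: ltW.
- by apply: phi_im_integrable; exact: ltW.
- exact: (integrableZl mD _ i3).
- by move=> y /half_lineP y0; rewrite mulr_ge0 ?sqrtr_ge0// kpos.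
- move=> y /half_lineP y0; rewrite [leRHS]exprMn sqr_sqrtr//.
  have := kpos _ y0; rewrite indicE.
  case: (boolP (y \in `]x, +oo[%classic)) => yx; last first.
    by rewrite mulr0 subr0 => _; rewrite onem_exp_le_ratio// ltW.
  have {}yx : x < y by move: yx; rewrite inE/= in_itv/= andbT.
  have ty : 8 <= t * y by rewrite (le_trans tx)// ler_pM2l// ltW.
  rewrite mulr1 => k0; apply: le_trans (onem_exp_lt_ratio t0 tb ty) _.
  have E := expRN8_le ty; rewrite ler_wpM2l//.
  rewrite lerXn2r ?nnegrE//; lra.
Qed.

Lemma normc_lexponent (q a b r : R) : 0 <= q -> 0 <= r ->
  phi_re mu a b ^+ 2 + phi_im mu a b ^+ 2 <= r ^+ 2 ->
  Normc.normc (laplace_exponent q 0 mu (a +i* b)) <= q + r.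
Proof.
move=> q0 r0 h; rewrite laplace_exponentE.
have -> : (q + phi_re mu a b) +i* phi_im mu a b =
   q%:C + (phi_re mu a b +i* phi_im mu a b).
  by apply/eqP; rewrite eq_complex/= add0r !eqxx.
apply: le_trans (le_normcD _ _) _; apply: lerD.
  by rewrite normc_pairE expr0n addr0 sqrtr_sqr ger0_norm.
exact: normc_le.
Qed.

(** This compares |phi(z)/z| with phi(t)/t for t = Re z: the killing term
    obeys it because |z| >= t, the integral by the kernel inequality. *)
Lemma exponent_ratio_le (q t b : R) : 0 <= q -> 0 < t ->
  Normc.normc (laplace_exponent q 0 mu (t +i* b)) * t <=
  Normc.normc (t +i* b) * (q + phi_re mu t 0).
Proof.
move=> q0 t0; rewrite normc_polar//.
have s0 : 0 <= 1 + (b / t) ^+ 2 by rewrite addr_ge0// sqr_ge0.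
have s1 : 1 <= Num.sqrt (1 + (b / t) ^+ 2).
  by rewrite -[leLHS]sqrtr1 ler_sqrt// lerDl sqr_ge0.
have U0 : 0 <= phi_re mu t 0.
  rewrite phi_re0E; apply: Rintegral_ge0 => y /half_lineP y0.
  by rewrite subr_ge0 expR_le1 oppr_le0 mulr_ge0// ltW.
have := @normc_lexponent q t b (Num.sqrt (1 + (b / t) ^+ 2) * phi_re mu t 0) q0.
rewrite mulr_ge0 ?sqrtr_ge0// => /(_ isT).
rewrite exprMn sqr_sqrtr// => /(_ (phi_norm_le b t0)).
move: (Normc.normc _) (Num.sqrt _) s1 => N s s1 h.
rewrite -mulrA [leRHS]mulrC ler_pM2r//; nra.
Qed.

End exponent.

(** * Lower bound on the argument, contraction of the modulus *)

Section core.
Context (R : realType) (mu : {measure set (measurableTypeR R) -> \bar R}).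
Context (hmu : levy_measure mu).
Local Notation D := (`]0%R, +oo[%classic : set (measurableTypeR R)).
Local Notation mD := (@measurable_half_line R).
Context (q x0 C rho : R) (q0 : 0 <= q) (x00 : 0 < x0) (C0 : 0 < C) (rho1 : rho < 1).
Context (tail_gt0 : forall x, 0 < x -> x < x0 -> 0 < levy_tail mu x).
Context (min_le : forall x, 0 < x -> x < x0 ->
  levy_min mu x <= C * (x * levy_tail mu x)).
Context (tail_dbl : forall x, 0 < x -> x < x0 ->
  levy_tail mu (2 * x) <= rho * levy_tail mu x).

Let phi := laplace_exponent q 0 mu.

Lemma phi_re0_gt0 (a : R) : 0 < a -> 0 < phi_re mu a 0.
Proof.
move=> a0; have xh : 0 < x0 / 2 by rewrite divr_gt0.
apply: lt_le_trans (phi_re0_ge hmu a0 xh).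
rewrite mulr_gt0 ?tail_gt0//; last by lra.
by rewrite subr_gt0 expR_lt1 oppr_lt0 mulr_gt0.
Qed.

Lemma phi_re_gt0 (a b : R) : 0 < a -> 0 < phi_re mu a b.
Proof.
move=> a0; apply: lt_le_trans (phi_re0_gt0 a0) _.
by apply: phi_re0_le => //; exact: ltW.
Qed.

(** The jumps larger than x = 8/|b|, on which the kernel inequality is strict,
    carry a fixed proportion of phi(t): phi(t) - q <= t m(1/t) <= t m(x) <= 24
    C T(x). The killing term q also gains a fixed factor, because |z| exceeds
    t by one. *)
Lemma exponent_ratio_lt : exists delta B : R, [/\ 0 < delta, delta < 1, 0 < B &
  forall t b : R, B <= `|b| -> `|b| <= t -> t <= 3 * `|b| ->
  Normc.normc (phi (t +i* b)) * t <=
  (1 - delta) * (Normc.normc (t +i* b) * (q + phi_re mu t 0))].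
Proof.
(* d2 phi(t) must stay below the gain T(x) / 100 of phi_norm_lt. *)
pose d2 := Num.min (1 / 100 / (24 * C)) (1 / 50).
have d20 : 0 < d2 by rewrite lt_min !divr_gt0// mulr_gt0.
have d250 : d2 <= 1 / 50 by rewrite ge_min lexx orbT.
have d2C : d2 * (24 * C) <= 1 / 100.
  have : d2 <= 1 / 100 / (24 * C) by rewrite ge_min lexx.
  by rewrite ler_pdivlMr ?mulr_gt0.
exists d2, (16 / x0); split => //; [lra|by rewrite divr_gt0|].
move=> t b bB bt tb; have b0 : 0 < `|b| by rewrite (lt_le_trans _ bB)// divr_gt0.
have t0 : 0 < t by exact: lt_le_trans bt.
pose x := 8 / `|b|.
have xp : 0 < x by rewrite divr_gt0.
have xb : x * `|b| = 8 by rewrite /x divfK// gt_eqF.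
have xx0 : x < x0.
  by move: bB; rewrite ler_pdivrMr// => bB; rewrite /x ltr_pdivrMr//; lra.
have tx : 8 <= t * x by rewrite -xb mulrC ler_pM2r.
have b2 : b ^+ 2 = `|b| ^+ 2 by rewrite real_normK ?num_real.
have tb2 : t ^+ 2 <= 9 * b ^+ 2 by rewrite b2; nra.
have h := phi_norm_lt hmu t0 xp tb2 tx.
have T0 := tail_gt0 xp xx0.
have U1 : phi_re mu t 0 <= 24 * C * levy_tail mu x.
  have ax : t^-1 <= x.
    by rewrite -(@ler_pM2l _ t)// mulfV ?gt_eqF//; lra.
  apply: le_trans (phi_re0_le_min hmu t0 ax) _.
  apply: (@le_trans _ _ (t * (C * (x * levy_tail mu x)))).
    by rewrite ler_pM2l// min_le.
  rewrite (_ : t * _ = (t * x) * (C * levy_tail mu x)); last by ring.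
  rewrite (_ : 24 * C * _ = 24 * (C * levy_tail mu x)); last by ring.
  have txl : t * x <= 24 by have := ler_wpM2l (ltW xp) tb; lra.
  by apply: ler_wpM2r => //; rewrite mulr_ge0// ltW.
have U0 : 0 < phi_re mu t 0 by exact: phi_re0_gt0.
have s0 : 0 <= 1 + (b / t) ^+ 2 by rewrite addr_ge0// sqr_ge0.
rewrite normc_polar//; set s := Num.sqrt _.
(* (21/20)^2 <= 10/9 <= 1 + (b/t)^2, and 49/50 * 21/20 >= 1 pays for q. *)
have s1 : 21 / 20 <= s.
  have -> : 21 / 20 = Num.sqrt ((21 / 20) ^+ 2) :> R by rewrite sqrtr_sqr ger0_norm.
  rewrite ler_sqrt// expr_div_n.
  have : 1 / 9 <= b ^+ 2 / t ^+ 2 by rewrite ler_pdivlMr ?exprn_gt0//; lra.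
  lra.
have h2 : phi_re mu t b ^+ 2 + phi_im mu t b ^+ 2 <=
    (s * ((1 - d2) * phi_re mu t 0)) ^+ 2.
  apply: le_trans h _; rewrite [leRHS]exprMn sqr_sqrtr//; apply: ler_wpM2l => //.
  have d2T : d2 * phi_re mu t 0 <= 1 / 100 * levy_tail mu x.
    apply: (@le_trans _ _ (d2 * (24 * C * levy_tail mu x))); first by rewrite ler_pM2l.
    by rewrite mulrA ler_pM2r.
  have Tge : 1 / 100 * levy_tail mu x <= phi_re mu t 0.
    apply: le_trans (phi_re0_ge hmu t0 xp); rewrite ler_pM2r//.
    by have := expRN8_le tx; lra.
  rewrite lerXn2r ?nnegrE//; lra.
have r0 : 0 <= s * ((1 - d2) * phi_re mu t 0).
  by rewrite !mulr_ge0 ?sqrtr_ge0 ?(ltW U0)//; lra.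
have := normc_lexponent q0 r0 h2; rewrite -/phi.
move: (Normc.normc _) (phi_re _ _ _) U0 => N U U0 hN.
rewrite (_ : (1 - d2) * _ = ((1 - d2) * s * (q + U)) * t); last by ring.
rewrite ler_pM2r//; apply: le_trans hN _.
have ds1 : 1 <= (1 - d2) * s by nra.
by have := ler_wpM2l q0 ds1; lra.
Qed.

(** The imaginary part of z * conj (phi(z)) at z = a + iw. *)
Definition phase (a w : R) : R := w * (q + phi_re mu a w) - a * phi_im mu a w.

Lemma phaseE (a w : R) : 0 <= a -> phase a w = q * w +
  \int[mu]_(y in D) (w * (1 - expR (- (a * y)) * cos (w * y)) -
     a * (expR (- (a * y)) * sin (w * y))).
Proof.
move=> a0.
have i1 := integrableZl mD w (phi_re_integrable hmu w a0).
have i2 := integrableZl mD a (phi_im_integrable hmu w a0).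
rewrite RintegralB//; try exact: mD.
rewrite !RintegralZl; first last.
- exact: phi_re_integrable.
- exact: mD.
- exact: phi_im_integrable.
- exact: mD.
rewrite /phase /phi_re /phi_im; ring.
Qed.

Lemma phase_integrable (a w : R) : 0 <= a -> mu.-integrable D
  (EFin \o (fun y : R => w * (1 - expR (- (a * y)) * cos (w * y)) -
     a * (expR (- (a * y)) * sin (w * y)))).
Proof.
move=> a0.
have i1 := integrableZl mD w (phi_re_integrable hmu w a0).
have i2 := integrableZl mD a (phi_im_integrable hmu w a0).
exact: (integrableB mD i1 i2).
Qed.

Lemma phase_ge0 (a w : R) : 0 <= a -> 0 <= w -> 0 <= phase a w.
Proof.
move=> a0 w0; rewrite phaseE// addr_ge0 ?mulr_ge0//.
by apply: Rintegral_ge0 => y /half_lineP y0; rewrite phase_kernel_ge0// ltW.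
Qed.

(** Only the jumps y with 1 < w y <= 2 are kept. *)
Lemma phase_lb (a w : R) : 0 <= a -> 0 < w -> a <= w -> w^-1 < x0 ->
  w * (q + expR (- 2) * (1 - cos 1) * (1 - rho) * levy_tail mu w^-1) <= phase a w.
Proof.
move=> a0 w0 aw wx; rewrite phaseE// mulrDr [w * q]mulrC lerD2l.
set x := w^-1; have xp : 0 < x by rewrite invr_gt0.
have x2p : 0 < 2 * x by rewrite mulr_gt0.
set c := expR (- 2) * (1 - cos 1).
have c0 : 0 <= c by rewrite mulr_ge0 ?expR_ge0// subr_ge0 cos_le1.
apply: (@le_trans _ _ (w * c * (levy_tail mu x - levy_tail mu (2 * x)))).
  rewrite [leLHS]mulrA [leLHS](_ : _ = w * c * ((1 - rho) * levy_tail mu x)); last by ring.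
  by rewrite ler_wpM2l ?mulr_ge0 ?(ltW w0)//; have := tail_dbl xp wx; lra.
have ix := levy_indic_integrable hmu xp; have ix2 := levy_indic_integrable hmu x2p.
have i3 := integrableB mD ix ix2.
rewrite -!levy_integral_indic// -RintegralB//; try exact: mD.
rewrite -RintegralZl//; try exact: mD.
apply: le_Rintegral; first exact: mD.
- exact: (integrableZl mD _ i3).
- exact: phase_integrable.
move=> y /half_lineP y0; have k0 := phase_kernel_ge0 a0 (ltW w0) (ltW y0).
rewrite /= !indic_itv_gt.
have [xy|yx] := ltP x y; last first.
  have -> : (2 * x < y) = false by apply/negbTE; rewrite -leNgt; lra.
  by rewrite subr0 mulr0.
have [xy2|yx2] := ltP (2 * x) y; first by rewrite subrr mulr0.
rewrite subr0 mulr1; apply: phase_kernel_lb => //.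
- by rewrite mulrC -ler_pdivrMr// div1r ltW.
- by rewrite mulrC -ler_pdivlMr.
Qed.

Lemma phi_norm_le_min (a w : R) : 0 <= a -> 0 < w -> a <= w ->
  Normc.normc (phi (a +i* w)) <= q + 2 * (w * levy_min mu w^-1).
Proof.
move=> a0 w0 aw; have xp : 0 < w^-1 by rewrite invr_gt0.
have im := levy_integrable_min hmu xp.
have m0 : 0 <= levy_min mu w^-1 by apply: levy_min_ge0; exact: ltW.
apply: normc_lexponent => //; first by rewrite !mulr_ge0// ltW.
rewrite mulrA /levy_min -RintegralZl//; try exact: mD.
apply: Rintegral_norm2_le; first exact: mD.
- exact: phi_re_integrable.
- exact: phi_im_integrable.
- exact: (integrableZl mD _ im).
- by move=> y /half_lineP y0; rewrite !mulr_ge0 ?le_min ?ltW.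
move=> y /half_lineP y0; apply: le_trans (onem_exp_le_min a0 aw (ltW y0)) _.
rewrite (_ : 2 * w * _ = 2 * Num.min (w * y) 1)//.
by rewrite -mulrA minr_pMr ?(ltW w0)// mulfV ?gt_eqF.
Qed.

Lemma phi_starE (a w : R) : 0 < a ->
  phi_star phi (a +i* w) =
  ((a * (q + phi_re mu a w) + w * phi_im mu a w) /
     ((q + phi_re mu a w) ^+ 2 + phi_im mu a w ^+ 2)) +i*
  (phase a w / ((q + phi_re mu a w) ^+ 2 + phi_im mu a w ^+ 2)).
Proof.
move=> a0; rewrite /phi_star /phi laplace_exponentE div_complexE//.
by rewrite ltr_wpDl// phi_re_gt0.
Qed.

Lemma phi_den_gt0 (a w : R) : 0 < a ->
  0 < (q + phi_re mu a w) ^+ 2 + phi_im mu a w ^+ 2.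
Proof.
by move=> a0; rewrite ltr_pwDl ?sqr_ge0// exprn_gt0// ltr_wpDl// phi_re_gt0.
Qed.

Lemma arg_phi_star_ge0 (a w : R) :
  0 < a -> 0 <= w -> 0 <= carg (phi_star phi (a +i* w)).
Proof.
move=> a0 w0; rewrite phi_starE//; apply: carg_ge0 => /=.
apply: divr_ge0; first by apply: phase_ge0 => //; exact: ltW.
by apply: ltW; exact: phi_den_gt0.
Qed.

(** If the phase vanishes then z / phi(z) is a positive real number, so that
    the reflection is valid there too. *)
Lemma arg_phi_starN (a w : R) : 0 < a -> 0 <= w ->
  carg (phi_star phi (a -i* w)) = - carg (phi_star phi (a +i* w)).
Proof.
move=> a0 w0; have n0 := phi_den_gt0 w a0.
have P0 : 0 < q + phi_re mu a w by rewrite ltr_wpDl// phi_re_gt0.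
rewrite [LHS](_ : _ = carg (((a * (q + phi_re mu a w) + w * phi_im mu a w) /
     ((q + phi_re mu a w) ^+ 2 + phi_im mu a w ^+ 2)) -i*
  (phase a w / ((q + phi_re mu a w) ^+ 2 + phi_im mu a w ^+ 2)))); last first.
  rewrite phi_starE// /phase phi_reN phi_imN ?(ltW a0)//; congr carg.
  apply/eqP; rewrite eq_complex/= !sqrrN; apply/andP; split; apply/eqP.
    by congr (_ / _); ring.
  by rewrite -[RHS]mulNr; congr (_ / _); ring.
rewrite carg_conj -?phi_starE//.
have := phase_ge0 (ltW a0) w0; rewrite le_eqVlt => /predU1P[ph0|ph0]; last first.
  by left; rewrite divr_gt0.
right; rewrite divr_gt0//.
have hQ : a * phi_im mu a w = w * (q + phi_re mu a w).
  by apply/esym/eqP; rewrite -subr_eq0 -/(phase a w) -ph0.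
have Q0 : 0 <= phi_im mu a w by rewrite -(@pmulr_rge0 _ a)// hQ mulr_ge0// ltW.
by rewrite ltr_pwDl ?mulr_gt0// mulr_ge0.
Qed.

(** The sine of the argument is phase / (|z| |phi(z)|); numerator and
    denominator are both comparable to w (q + T(1/w)). *)
Lemma arg_phi_star_ge : exists eps a0 : R, [/\ 0 < eps, 0 < a0 &
  forall a w, a0 <= a -> a <= w -> eps <= carg (phi_star phi (a +i* w))].
Proof.
set c := expR (- 2) * (1 - cos 1) * (1 - rho).
have c0 : 0 < c.
  rewrite !mulr_gt0 ?expR_gt0 ?subr_gt0// -[ltRHS]cos0 ltr_cos ?ltr01//.
    by rewrite in_itv/= lexx pi_ge0.
  rewrite in_itv/= ler01/=.
  by have := @pi_ge2 R; lra.
pose eps := Num.min 1 (c / (2 * C)) / 2.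
have e0 : 0 < eps by rewrite divr_gt0// lt_min ltr01 divr_gt0// mulr_gt0.
have e1 : 2 * eps <= 1.
  by rewrite /eps mulrCA mulfV ?mulr1// ge_min lexx.
have eC : 2 * eps * (2 * C) <= c.
  rewrite -ler_pdivlMr ?mulr_gt0// /eps mulrCA mulfV ?mulr1// ge_min lexx orbT//.
exists eps, (2 / x0); split => //; first by rewrite divr_gt0.
move=> a w a0a aw.
have a0 : 0 < a by rewrite (lt_le_trans _ a0a)// divr_gt0.
have w0 : 0 < w by exact: lt_le_trans aw.
have wx : w^-1 < x0.
  have : 2 / x0 <= w by exact: le_trans aw.
  rewrite ler_pdivrMr// => h.
  by rewrite -(@ltr_pM2l _ w)// mulfV ?gt_eqF//; lra.
have wp : 0 < w^-1 by rewrite invr_gt0.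
have T0 := tail_gt0 wp wx.
have n0 := phi_den_gt0 w a0.
have P0 : 0 < q + phi_re mu a w by rewrite ltr_wpDl// phi_re_gt0.
have phn : 0 < Normc.normc (phi (a +i* w)).
  by rewrite /phi laplace_exponentE normc_pairE sqrtr_gt0.
have zn : 0 < Normc.normc (a +i* w).
  by rewrite normc_pairE sqrtr_gt0 ltr_pwDl ?exprn_gt0// sqr_ge0.
have nE : Normc.normc (phi_star phi (a +i* w)) =
    Normc.normc (a +i* w) / Normc.normc (phi (a +i* w)).
  by rewrite /phi_star Normc.normcM Normc.normcV.
have z2w : Normc.normc (a +i* w) <= 2 * w.
  by apply: normc_le => /=; [rewrite mulr_ge0// ltW|nra].
have ph := phase_lb (ltW a0) w0 aw wx; rewrite -/c in ph.
have phi2 : Normc.normc (phi (a +i* w)) <= q + 2 * C * levy_tail mu w^-1.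
  apply: le_trans (phi_norm_le_min (ltW a0) w0 aw) _.
  rewrite lerD2l -mulrA ler_pM2l//.
  apply: (@le_trans _ _ (w * (C * (w^-1 * levy_tail mu w^-1)))).
    by rewrite ler_pM2l// min_le.
  by rewrite mulrCA [w * (_ * _)]mulrA mulfV ?gt_eqF// mul1r.
have imE : complex.Im (phi_star phi (a +i* w)) =
    phase a w / Normc.normc (phi (a +i* w)) ^+ 2.
  by rewrite phi_starE// normc_sqr /phi laplace_exponentE.
have key : eps * (Normc.normc (a +i* w) * Normc.normc (phi (a +i* w))) <= phase a w.
  apply: le_trans ph.
  apply: (@le_trans _ _ (eps * (2 * w * (q + 2 * C * levy_tail mu w^-1)))).
    by rewrite ler_pM2l// ler_pM// ltW.
  rewrite (_ : eps * _ =
    w * (2 * eps * q + 2 * eps * (2 * C) * levy_tail mu w^-1)); last by ring.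
  rewrite ler_pM2l// lerD//; first by rewrite -[leRHS]mul1r ler_wpM2r.
  by rewrite ler_pM2r.
apply: carg_ge.
- by rewrite nE divr_gt0.
- rewrite imE; apply: divr_ge0; last by rewrite exprn_ge0// ltW.
  by apply: phase_ge0; exact: ltW.
rewrite nE imE.
move: zn phn key; move: (Normc.normc (a +i* w)) (Normc.normc (phi (a +i* w))).
move=> Z F zn phn key.
rewrite ler_pdivlMr ?exprn_gt0// (_ : _ * F ^+ 2 = eps * (Z * F))//.
by field; rewrite gt_eqF.
Qed.

Lemma A_fun_ge : exists eps a0 : R, [/\ 0 < eps, 0 < a0 &
  forall eps' a b, 0 <= eps' -> eps' <= eps -> a0 <= a -> a <= `|b| ->
    eps' * (`|b| - a) <= A_fun (phi_star phi) a b].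
Proof.
have [eps [a0 [e0 a00 H]]] := arg_phi_star_ge.
exists eps, a0; split => // e a b e0' ee a0a; rewrite /A_fun /integral_from0.
have ap : 0 < a by exact: lt_le_trans a0a.
have [b0|b0] := leP 0 b => ab.
  rewrite ger0_norm// in ab *.
  apply: (@Rintegral_itv_ge _ _ _ _ _ _ _ pi) => //; first exact: ltW.
  - move=> w /andP[w0 wb]; rewrite arg_phi_star_ge0//=.
    by apply: le_trans (ler_norm _) _; exact: carg_le_pi.
  - by move=> w /andP[aw wb]; apply: le_trans ee _; exact: H.
rewrite ltr0_norm// in ab *.
pose g w := - carg (phi_star phi (a +i* w)).
have gE w : w <= 0 -> g w = carg (phi_star phi (a +i* (- w))).
  by move=> w0; rewrite /g -[w in LHS]opprK arg_phi_starN ?oppr_ge0// opprK.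
rewrite (_ : - _ = \int[lebesgue_measure]_(w in `[b, 0]) g w); last first.
  rewrite /Rintegral -fineN; congr fine.
  rewrite -[RHS]oppeK; congr (- _)%E; rewrite -integral_ge0N; last first.
    move=> w /=; rewrite in_itv/= => /andP[_ w0].
    by rewrite gE// lee_fin arg_phi_star_ge0 ?oppr_ge0.
  by apply: eq_integral => w _; rewrite /g EFinN oppeK.
rewrite (_ : - b - a = - a - b); last by rewrite addrC.
apply: (@Rintegral_itv_ge _ _ _ _ _ _ _ pi) => //; try lra.
- move=> w /andP[bw w0]; rewrite gE// arg_phi_star_ge0 ?oppr_ge0//=.
  by apply: le_trans (ler_norm _) _; exact: carg_le_pi.
- move=> w /andP[bw wa]; rewrite gE; last by lra.
  by apply: le_trans ee _; apply: H => //; lra.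
Qed.
End core.

(** * Small jumps under positive increase and regular variation *)

Lemma near0_rightP (R : realType) (P : set R) : 0^'+ P ->
  exists2 eta : R, 0 < eta & forall x, 0 < x -> x < eta -> P x.
Proof.
move=> /nbhs_ballP[e /= e0 H]; exists e => // x x0 xe.
by apply: H => //; rewrite /ball/= sub0r normrN gtr0_norm.
Qed.

Lemma cvg_right0_near (R : realType) (f : R -> R) (l a b : R) :
  f x @[x --> 0^'+] --> l -> a < l -> l < b ->
  exists2 eta : R, 0 < eta & forall x, 0 < x -> x < eta -> a < f x < b.
Proof.
move=> fl al lb; apply: near0_rightP.
have h1 : \forall x \near 0^'+, a < f x by exact: (cvgr_gt _ fl).
have h2 : \forall x \near 0^'+, f x < b by exact: (cvgr_lt _ fl).
by apply: filterS2 h1 h2 => x -> ->.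
Qed.

(** The lower limit may be infinite, so the threshold r is chosen by cases. *)
Lemma lt_limf_einf_near (R : realType) (f : R -> R) :
  (1 < limf_einf (fun x => (f x)%:E) 0^'+)%E ->
  exists r eta : R, [/\ 1 < r, 0 < eta & forall x, 0 < x -> x < eta -> r <= f x].
Proof.
rewrite limf_einfE => /ereal_sup_gt[_ [V VF <-] hV].
have [eta eta0 etaV] := near0_rightP VF.
have fV x : 0 < x -> x < eta -> (ereal_inf [set (f x)%:E | x in V] <= (f x)%:E)%E.
  by move=> x0 xe; apply: ereal_inf_lbound; exists x => //; exact: etaV.
move: hV fV; case: ereal_inf => [r| |].
- by rewrite lte_fin => r1 fV; exists r, eta; split => // x x0 xe; rewrite -lee_fin fV.
- move=> _ fV; exists 2, eta; split => // [|x x0 xe]; first by lra.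
  by have := fV x x0 xe; rewrite leye_eq.
- by rewrite ltNge leNye.
Qed.

Lemma lt_limf_esup_near (R : realType) (f : R -> R) :
  (limf_esup (fun x => (f x)%:E) 0^'+ < 1)%E ->
  exists r eta : R, [/\ r < 1, 0 < eta & forall x, 0 < x -> x < eta -> f x <= r].
Proof.
rewrite limf_esupE => /ereal_inf_lt[_ [V VF <-] hV].
have [eta eta0 etaV] := near0_rightP VF.
have fV x : 0 < x -> x < eta -> ((f x)%:E <= ereal_sup [set (f x)%:E | x in V])%E.
  by move=> x0 xe; apply: ereal_sup_ubound; exists x => //; exact: etaV.
move: hV fV; case: ereal_sup => [r| |].
- by rewrite lte_fin => r1 fV; exists r, eta; split => // x x0 xe; rewrite -lee_fin fV.
- by rewrite ltNge leey.
- move=> _ fV; exists 0, eta; split => // x x0 xe.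
  by have := fV x x0 xe; rewrite leeNy_eq.
Qed.

Section small_jumps.
Context (R : realType) (mu : {measure set (measurableTypeR R) -> \bar R}).
Context (hmu : levy_measure mu).

(** As m(x / 2^n) tends to 0, it can be dropped at the end of a dyadic
    induction. *)
Lemma levy_min_le_lim (x K : R) : 0 < x ->
  (forall n, levy_min mu x <= K + levy_min mu (x / 2 ^+ n)) -> levy_min mu x <= K.
Proof.
move=> x0 h; have cv := levy_min_cvg0 hmu x0.
have cK : K + levy_min mu (x / 2 ^+ n) @[n --> \oo] --> K.
  by rewrite -[X in _ --> X]addr0; apply: cvgD => //; exact: cvg_cst.
rewrite -(cvg_lim _ cK)//; apply: limr_ge.
  by apply/cvg_ex; exists K.
exact: nearW.
Qed.

Lemma levy_min_half (x : R) : 0 < x ->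
  levy_min mu x <= x / 2 * levy_tail mu (x / 2) + levy_min mu (x / 2).
Proof.
move=> x0; have xh : 0 < x / 2 by rewrite divr_gt0.
have := levy_min_sub hmu xh; rewrite (_ : 2 * (x / 2) = x); last by field.
lra.
Qed.

Lemma half_expr (x : R) n : x / 2 / 2 ^+ n = x / 2 ^+ n.+1.
Proof. by rewrite exprS; field; rewrite expf_neq0. Qed.

(** Dyadic induction; (2 kappa - 1)^-1 is the solution C of (1 + C) / (2
    kappa) = C, and the sum of the geometric series of ratio (2 kappa)^-1. *)
Lemma levy_min_le_regular (kappa eta : R) : 1 < 2 * kappa ->
  (forall x, 0 < x -> x < eta -> kappa * levy_tail mu x <= levy_tail mu (2 * x)) ->
  forall x, 0 < x -> x < eta ->
  levy_min mu x <= (2 * kappa - 1)^-1 * (x * levy_tail mu x).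
Proof.
move=> k1 hk x x0 xe; apply: levy_min_le_lim => // n.
elim: n x x0 xe => [|n IH] x x0 xe.
  rewrite expr0 divr1 lerDr mulr_ge0 ?invr_ge0 ?mulr_ge0 ?levy_tail_ge0//; lra.
have xh : 0 < x / 2 by rewrite divr_gt0.
apply: le_trans (levy_min_half x0) _.
have xhe : x / 2 < eta by lra.
have := IH _ xh xhe; rewrite half_expr => {}IH.
have := hk _ xh xhe; rewrite (_ : 2 * (x / 2) = x); last by field.
move=> hx; suff : x / 2 * levy_tail mu (x / 2) +
    (2 * kappa - 1)^-1 * (x / 2 * levy_tail mu (x / 2)) <=
    (2 * kappa - 1)^-1 * (x * levy_tail mu x) by lra.
have c0 : 0 < 2 * kappa - 1 by lra.
rewrite (_ : x / 2 * _ + _ =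
  (2 * kappa - 1)^-1 * (x * (kappa * levy_tail mu (x / 2)))); last first.
  by field; rewrite gt_eqF.
by rewrite !ler_pM2l ?invr_gt0.
Qed.

Lemma measurable_levy_tail :
  measurable_fun (`]0%R, +oo[%classic : set R) (levy_tail mu).
Proof.
apply: (measurability (@RGenCInfty.G R)) => [|/= _ [_] [r] -> <-].
  exact: RGenCInfty.measurableE.
apply: is_interval_measurable => s t/=.
rewrite !in_itv/= !andbT => -[s0 fs] [t0 ft] u /andP[su ut].
have u0 : 0 < u by exact: lt_le_trans su.
by rewrite !in_itv/= !andbT u0 (le_trans ft)// levy_tail_nonincreasing.
Qed.

Let I (x : R) : R := \int[lebesgue_measure]_(y in `]0, x]) levy_tail mu y.

(** Monotonicity of the tail on ]x, y]. The real-valued integral of a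
    nonnegative measurable function is nonzero only if the extended one is
    finite, so I y != 0 provides integrability. *)
Lemma tail_integral_sub (x y : R) : 0 < x -> x <= y -> I y != 0 ->
  (y - x) * levy_tail mu y <= I y - I x /\ I y - I x <= (y - x) * levy_tail mu x.
Proof.
move=> x0 xy Iy0.
have mt (A : set R) : measurable A -> A `<=` `]0, +oo[%classic ->
    measurable_fun A (levy_tail mu).
  by move=> mA AD; apply: measurable_funS measurable_levy_tail.
have sy : `]0, y]%classic `<=` `]0%R, +oo[%classic by apply: subset_itvl; rewrite bnd_simp.
have int_y : lebesgue_measure.-integrable `]0, y] (EFin \o levy_tail mu).
  apply/integrableP; split; first by apply/measurable_EFinP; exact: mt.
  under eq_integral do rewrite /= ger0_norm ?levy_tail_ge0//.
  rewrite ltey; apply/eqP => h; move/eqP: Iy0; apply.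
  by rewrite /I /Rintegral h.
have sxy : `]x, y]%classic `<=` `]0, y]%classic by apply: subset_itvr; rewrite bnd_simp ltW.
have int_xy : lebesgue_measure.-integrable `]x, y] (EFin \o levy_tail mu).
  exact: integrableS int_y.
rewrite /I Rintegral_itvB//; last by rewrite bnd_simp ltW.
have lxy : fine (lebesgue_measure (`]x, y]%classic : set R)) = y - x.
  rewrite lebesgue_measure_itv/= lte_fin; move: xy; rewrite le_eqVlt => /predU1P[->|->//].
  by rewrite ltxx subrr.
have int_c (c : R) : lebesgue_measure.-integrable `]x, y] (EFin \o cst c).
  apply/integrableP; split; first exact/measurable_EFinP.
  rewrite (_ : integral _ _ _ =
      (\int[lebesgue_measure]_(z in `]x, y]) cst `|c|%:E z)%E)//.
  rewrite integral_cst//= lebesgue_measure_itv/=; case: ifP => _.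
    by rewrite -EFinB -EFinM ltry.
  by rewrite mule0 ltry.
rewrite -lxy [_ * levy_tail mu y]mulrC [_ * levy_tail mu x]mulrC -!Rintegral_cst//.
split; apply: le_Rintegral => //; try exact: int_c;
  move=> z /=; rewrite in_itv/= => /andP[xz zy].
  by apply: levy_tail_nonincreasing => //; exact: lt_trans xz.
by apply: levy_tail_nonincreasing => //; exact: ltW.
Qed.

(** Ratios I(2x)/I(x) above r > 1 force I(x) > 0, hence a finite integral.
    Telescoping m(x) - m(x/2) <= (x/2) T(x/2) <= 2 (I(x/2) - I(x/4)) gives
    m(x) <= 2 I(x/2). *)
Lemma positive_increase_small_jumps : positive_increase mu ->
  exists C eta : R, [/\ 0 < C, 0 < eta &
    forall x, 0 < x -> x < eta -> 0 < levy_tail mu x /\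
      levy_min mu x <= C * (x * levy_tail mu x)].
Proof.
move=> /lt_limf_einf_near[r [eta [r1 eta0 H]]].
have I0 x : 0 <= I x by apply: Rintegral_ge0 => y _; exact: levy_tail_ge0.
have Ipos x : 0 < x -> x < eta -> 0 < I x /\ r * I x <= I (2 * x).
  move=> x0 xe; have := H x x0 xe; rewrite -!/(I _) => h.
  have In0 : I x != 0.
    by apply/eqP => Ix0; move: h; rewrite Ix0 invr0 mulr0; lra.
  have Ixp : 0 < I x by rewrite lt_neqAle eq_sym In0 I0.
  by split => //; rewrite -ler_pdivlMr.
have I20 x : 0 < x -> x < eta -> I (2 * x) != 0.
  move=> x0 xe; have [h1 h2] := Ipos x x0 xe; rewrite gt_eqF//.
  by rewrite (lt_le_trans _ h2)// mulr_gt0//; lra.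
have r10 : 0 < r - 1 by lra.
have IT x : 0 < x -> x < eta -> (r - 1) * I x <= x * levy_tail mu x.
  move=> x0 xe; have x2x : x <= 2 * x by lra.
  have [_ ] := tail_integral_sub x0 x2x (I20 x x0 xe).
  have [] := Ipos x x0 xe; rewrite (_ : 2 * x - x = x); last by ring.
  by move=> _ h1 h2; apply: le_trans h2; lra.
exists (2 / (r - 1)), eta; split => //; first by rewrite divr_gt0.
move=> x x0 xe; split.
  have := IT x x0 xe; have [Ip _] := Ipos x x0 xe => h.
  by rewrite -(@pmulr_rgt0 _ x)//; apply: lt_le_trans h; rewrite mulr_gt0.
apply: (@le_trans _ _ (2 * I x)); last first.
  by rewrite -mulrA ler_pM2l// mulrC ler_pdivlMr// mulrC IT.
apply: (@le_trans _ _ (2 * I (x / 2))); last first.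
  have xh : 0 < x / 2 by rewrite divr_gt0.
  have xhx : x / 2 <= x by lra.
  have [Ip _] := Ipos x x0 xe.
  have [h _] := tail_integral_sub xh xhx (lt0r_neq0 Ip).
  have : 0 <= (x - x / 2) * levy_tail mu x by rewrite mulr_ge0 ?levy_tail_ge0//; lra.
  lra.
apply: levy_min_le_lim => // n; elim: n x x0 xe => [|n IH] x x0 xe.
  by rewrite expr0 divr1 lerDr mulr_ge0.
have xh : 0 < x / 2 by rewrite divr_gt0.
have xhe : x / 2 < eta by lra.
apply: le_trans (levy_min_half x0) _.
have := IH _ xh xhe; rewrite half_expr => {}IH.
have xq : 0 < x / 2 / 2 by rewrite divr_gt0.
have xqh : x / 2 / 2 <= x / 2 by lra.
have [Ip _] := Ipos _ xh xhe.
have [h _] := tail_integral_sub xq xqh (lt0r_neq0 Ip).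
lra.
Qed.

End small_jumps.

Lemma cvg_mull_right0 (R : realType) (f : R -> R) (c l : R) : 0 < c ->
  f x @[x --> 0^'+] --> l -> f (c * x) @[x --> 0^'+] --> l.
Proof.
move=> c0 fl; apply: (cvg_comp (fun x => c * x) f _ fl).
move=> A /near0_rightP[e e0 H].
apply/nbhs_ballP; exists (e / c) => /=; first by rewrite divr_gt0.
move=> x; rewrite /ball/= sub0r normrN => xe x0; apply: H; first by rewrite mulr_gt0.
by move: xe; rewrite gtr0_norm// ltr_pdivlMr// mulrC.
Qed.

(** Write T(y) = r(y) y^(-alpha) l(y) with r -> 1; the factors r and l have
    ratio tending to 1 between 2x and x. *)
Lemma regular_variation_ratio (R : realType)
    (mu : {measure set (measurableTypeR R) -> \bar R}) (alpha : R) (l : R -> R) :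
  slowly_varying_at0 l ->
  levy_tail mu y / (y `^ (- alpha) * l y) @[y --> 0^'+] --> (1 : R) ->
  (exists2 eta : R, 0 < eta & forall x, 0 < x -> x < eta -> 0 < levy_tail mu x) /\
  levy_tail mu (2 * x) / levy_tail mu x @[x --> 0^'+] --> 2 `^ (- alpha).
Proof.
move=> [[x0 x00 [_ l0]] ls] H.
set r := fun y => levy_tail mu y / (y `^ (- alpha) * l y).
have [e e0 re] := @cvg_right0_near _ r 1 (1 / 2) 2 H ltac:(lra) ltac:(lra).
pose m := Num.min e x0.
have m0 : 0 < m by rewrite lt_min e0.
have dpos x : 0 < x -> x < m -> 0 < x `^ (- alpha) * l x.
  move=> xp; rewrite lt_min => /andP[xe xx0].
  by rewrite mulr_gt0 ?powR_gt0// l0// xp.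
have rpos x : 0 < x -> x < m -> 0 < r x.
  move=> xp; rewrite lt_min => /andP[xe xx0].
  by have /andP[h _] := re x xp xe; apply: lt_trans h; lra.
have tE x : 0 < x -> x < m -> levy_tail mu x = r x * (x `^ (- alpha) * l x).
  by move=> xp xm; rewrite /r divfK// gt_eqF// dpos.
have tpos x : 0 < x -> x < m -> 0 < levy_tail mu x.
  by move=> xp xm; rewrite tE// mulr_gt0 ?rpos ?dpos.
split; first by exists m.
have cv : r (2 * x) / r x * (2 `^ (- alpha) * (l (2 * x) / l x)) @[x --> 0^'+] -->
    1 / 1 * (2 `^ (- alpha) * 1).
  apply: cvgM.
    apply: cvgM; first exact: cvg_mull_right0.
    by apply: cvgV => //; exact: oner_neq0.
  by apply: cvgM; [exact: cvg_cst|exact: ls].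
rewrite divr1 mul1r mulr1 in cv.
apply: cvg_trans cv; apply: near_eq_cvg; near=> x.
have xp : 0 < x by [].
have x2p : 0 < 2 * x by rewrite mulr_gt0.
have x2m : 2 * x < m.
  rewrite mulrC -ltr_pdivlMr//; near: x; apply: nbhs_right_lt; by rewrite divr_gt0.
have xm : x < m by lra.
rewrite [in RHS]tE// [in RHS](tE x)// powRM ?(ltW xp)//.
have h1 := rpos _ xp xm; have := dpos _ xp xm; rewrite pmulr_rgt0 ?powR_gt0// => h2.
by field; rewrite !gt_eqF// powR_gt0.
Unshelve. all: end_near.
Qed.

Lemma half_lt_powR2N (R : realType) (alpha : R) : 0 < alpha -> alpha < 1 ->
  1 / 2 < (2 : R) `^ (- alpha) < 1.
Proof.
move=> a0 a1; have l2 : 0 < ln 2 :> R by rewrite ln_gt0//; lra.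
rewrite /powR (gt_eqF (_ : 0 < 2))//; apply/andP; split.
  have -> : 1 / 2 = expR (- ln 2) :> R by rewrite expRN lnK ?posrE// div1r.
  by rewrite ltr_expR; nra.
by rewrite expR_lt1; nra.
Qed.

(** * The Gamma function on the right half-plane *)

Section half_line.
Context (R : realType).
Local Notation leb := (@lebesgue_measure R).
Implicit Types (f F : R -> R).

Local Notation mD := (@measurable_half_line R).

Let K (n : nat) : set (measurableTypeR R) := `[n.+1%:R^-1, n.+2%:R]%classic.

Let K_pos n : K n `<=` `]0, +oo[%classic.
Proof.
by move=> x; rewrite /K /= !in_itv/= andbT => /andP[+ _]; apply: lt_le_trans; rewrite invr_gt0.
Qed.

Let K_homo : nondecreasing_seq K.
Proof.
move=> m n mn; apply/subsetPset => x; rewrite /K/= !in_itv/= => /andP[h1 h2].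
apply/andP; split.
  by apply: le_trans h1; rewrite lef_pV2 ?posrE// ler_nat ltnS.
by apply: le_trans h2 _; rewrite ler_nat !ltnS.
Qed.

Let K_mem (x : R) : 0 < x -> exists n, forall m, (n <= m)%N -> K m x.
Proof.
move=> x0; exists (maxn (Num.bound x) (Num.bound x^-1)) => m.
rewrite geq_max => /andP[h1 h2]; rewrite /K/= in_itv/=; apply/andP; split.
  rewrite -[leRHS]invrK lef_pV2 ?posrE ?invr_gt0//.
  apply: (@le_trans _ _ (Num.bound x^-1)%:R); last by rewrite ler_nat (leq_trans h2).
  by apply: ltW; apply: archi_boundP; rewrite invr_ge0 ltW.
apply: (@le_trans _ _ (Num.bound x)%:R); last first.
  by rewrite ler_nat (leq_trans h1)// (leq_trans (leqnSn _)).
by apply: ltW; apply: archi_boundP; exact: ltW.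
Qed.

Let K_bigcup : \bigcup_n K n = `]0, +oo[%classic.
Proof.
apply/seteqP; split => [x [n _ /K_pos//]|x]; rewrite /= in_itv/= andbT => /K_mem[n h].
by exists n => //; apply: h.
Qed.

Let K_FTC f F n : (forall t : R, 0 < t -> is_derive t (1 : R) F (f t)) ->
  (forall t, 0 < t -> {for t, continuous f}) ->
  (\int[leb]_(t in K n) (f t)%:E = (F n.+2%:R - F n.+1%:R^-1)%:E)%E.
Proof.
move=> dF cf.
have lt12 : n.+1%:R^-1 < n.+2%:R :> R.
  by apply: (@le_lt_trans _ _ 1); [rewrite invf_le1 ?ler1n|rewrite ltr1n].
have dF' t : 0 < t -> derivable F t 1.
  by move=> t0; exact: (@ex_derive _ _ _ _ _ _ _ (dF t t0)).
have cF t : 0 < t -> {for t, continuous F}.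
  by move=> t0; apply/differentiable_continuous/derivable1_diffP/dF'.
rewrite (@continuous_FTC2 _ f F)//.
- apply: continuous_in_subspaceT => t; rewrite inE => /K_pos /=.
  by rewrite in_itv/= andbT => /cf.
- split.
  + move=> t; rewrite in_itv/= => /andP[h _]; apply: dF'.
    by apply: lt_trans h; rewrite invr_gt0.
  + apply: cvg_at_right_filter; apply: cF; by rewrite invr_gt0.
  + by apply: cvg_at_left_filter; apply: cF.
- move=> t; rewrite in_itv/= => /andP[h _]; rewrite derive1E.
  have t0 : 0 < t by apply: lt_trans h; rewrite invr_gt0.
  by have [_ ->] := dF t t0.
Qed.

Lemma continuous_pos_measurable f : (forall t, 0 < t -> {for t, continuous f}) ->
  measurable_fun (`]0, +oo[%classic : set R) f.
Proof.
move=> cf; apply: open_continuous_measurable_fun => //.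
by move=> t; rewrite inE/= in_itv/= andbT => /cf.
Qed.

(** Integrability of a nonnegative derivative of a bounded function, obtained
    by monotone convergence along the intervals K n. *)
Lemma integrable_derive_bounded f F (M : R) :
  (forall t : R, 0 < t -> is_derive t (1 : R) F (f t)) ->
  (forall t, 0 < t -> {for t, continuous f}) ->
  (forall t, 0 < t -> 0 <= f t) -> (forall t, 0 < t -> 0 <= F t <= M) ->
  leb.-integrable `]0, +oo[ (EFin \o f).
Proof.
move=> dF cf f0 FM; have mf := continuous_pos_measurable cf.
apply/integrableP; split; first exact/measurable_EFinP.
rewrite (_ : integral _ _ _ = (\int[leb]_(t in `]0%R, +oo[) (f t)%:E)%E); last first.
  apply: eq_integral => t; rewrite inE/= in_itv/= andbT => t0.
  by rewrite ger0_norm ?f0.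
have cv := @ge0_nondecreasing_set_cvg_integral _ (measurableTypeR R) R K
  (EFin \o f) leb K_homo.
rewrite K_bigcup in cv.
apply: (@le_lt_trans _ _ M%:E); last by rewrite ltry.
have {}cv : (\int[leb]_(x in K i) (EFin \o f) x)%E @[i --> \oo] -->
    (\int[leb]_(x in `]0%R, +oo[) (EFin \o f) x)%E.
  apply: cv => [i|i|i x /K_pos]; first exact: measurable_itv.
    apply/measurable_EFinP; apply: measurable_funS mf => //; exact: K_pos.
  by rewrite /= in_itv/= andbT lee_fin => /f0.
rewrite -(cvg_lim _ cv)//; apply: lime_le; first by apply/cvg_ex; eexists; exact: cv.
apply: nearW => n; rewrite /comp (K_FTC n dF cf) lee_fin.
have := FM n.+2%:R; have := FM n.+1%:R^-1.
rewrite invr_gt0 !ltr0n => /(_ isT) h1 /(_ isT) h2.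
lra.
Qed.

(** The integral over ]0, +oo[ of the derivative of a function that vanishes
    at both ends; this is the boundary-free integration by parts for the Gamma
    function. *)
Lemma integral_derive_eq0 f F :
  (forall t : R, 0 < t -> is_derive t (1 : R) F (f t)) ->
  (forall t, 0 < t -> {for t, continuous f}) ->
  leb.-integrable `]0, +oo[ (EFin \o f) ->
  F n.+1%:R^-1 @[n --> \oo] --> (0 : R) -> F n.+2%:R @[n --> \oo] --> (0 : R) ->
  \int[leb]_(t in `]0, +oo[) f t = 0.
Proof.
move=> dF cf fi F0 Foo; have mf := continuous_pos_measurable cf.
have [|||||] := @dominated_convergence _ (measurableTypeR R) R leb
  (`]0, +oo[%classic : set (measurableTypeR R)) mD
  (fun n => (EFin \o f) \_ (K n)) (EFin \o f) (abse \o (EFin \o f)).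
- move=> n; apply/measurable_restrict => //; first exact: measurable_itv.
  apply: measurable_funS (measurable_int _ fi); [exact: mD|exact: subIsetl].
- exact/measurable_EFinP.
- apply: aeW => x /=; rewrite in_itv/= andbT => x0; have [n hn] := K_mem x0.
  apply: cvg_near_cst; exists n => // m /= nm.
  by rewrite patchE mem_set//; exact: hn.
- exact: integrable_abse.
- apply: aeW => x n _; rewrite patchE; case: ifP => //= _.
  by rewrite normr0 lee_fin.
move=> _ _.
have Kint n : (\int[leb]_(x in `]0%R, +oo[) ((EFin \o f) \_ (K n)) x)%E =
    (F n.+2%:R - F n.+1%:R^-1)%:E.
  by rewrite -integral_mkcondr setIidr ?K_FTC//; exact: K_pos.
rewrite (_ : [sequence _]_n = fun n => (F n.+2%:R - F n.+1%:R^-1)%:E); last first.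
  by apply/funext => n; exact: Kint.
have h0 : (F n.+2%:R - F n.+1%:R^-1)%:E @[n --> \oo] --> (0%:E : \bar R).
  by apply: cvg_EFin; [exact: nearW|rewrite /comp -(subrr 0) /=; apply: cvgB].
by move=> /(cvg_unique _ h0); rewrite /Rintegral => <-.
Qed.

End half_line.

Section gamma.
Context (R : realType).
Local Notation leb := (@lebesgue_measure R).
Local Notation D := (`]0%R, +oo[%classic : set (measurableTypeR R)).
Local Notation mD := (@measurable_half_line R).

(** With gamma_sin, the real and imaginary parts of t^(a+ib) e^(-t). *)
Definition gamma_cos (a b t : R) : R := expR (a * ln t) * cos (b * ln t) * expR (- t).
Definition gamma_sin (a b t : R) : R := expR (a * ln t) * sin (b * ln t) * expR (- t).
Definition gamma_abs (a t : R) : R := expR (a * ln t) * expR (- t).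

Lemma is_derive_comp_ln (k dk : R -> R) (t : R) : 0 < t ->
  (forall s : R, is_derive s (1 : R) k (dk s)) ->
  is_derive t (1 : R) (fun t => k (ln t) * expR (- t))
   (dk (ln t) * expR (- ln t) * expR (- t) - k (ln t) * expR (- t)).
Proof.
move=> t0 dkP.
have h1 : is_derive t (1 : R) (k \o @ln R) (dk (ln t) * t^-1).
  by apply: is_derive1_comp; exact: is_derive1_ln.
have h2 : is_derive t (1 : R) (expR \o (fun t => - t)) (expR (- t) * -1).
  by apply: is_derive1_comp.
have := is_deriveM h1 h2.
move=> h; apply: is_derive_eq h _.
by rewrite /GRing.scale/= [expR (- ln t)]expRN lnK ?posrE//; ring.
Qed.

Lemma is_derive_expR_mul (a s : R) :
  is_derive s (1 : R) (fun s => expR (a * s)) (a * expR (a * s)).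
Proof.
have h : is_derive s (1 : R) (fun s => a * s) a.
  by apply: is_derive_eq; rewrite /GRing.scale/= mulr1.
have := @is_derive1_comp R expR (fun s => a * s) s _ _ (is_derive_expR _) h.
by move=> h'; apply: is_derive_eq h' _; rewrite mulrC.
Qed.

Lemma is_derive_cos_mul (b s : R) :
  is_derive s (1 : R) (fun s => cos (b * s)) (- b * sin (b * s)).
Proof.
have h : is_derive s (1 : R) (fun s => b * s) b.
  by apply: is_derive_eq; rewrite /GRing.scale/= mulr1.
have := @is_derive1_comp R cos (fun s => b * s) s _ _ (is_derive_cos _) h.
by move=> h'; apply: is_derive_eq h' _; ring.
Qed.

Lemma is_derive_sin_mul (b s : R) :
  is_derive s (1 : R) (fun s => sin (b * s)) (b * cos (b * s)).
Proof.
have h : is_derive s (1 : R) (fun s => b * s) b.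
  by apply: is_derive_eq; rewrite /GRing.scale/= mulr1.
have := @is_derive1_comp R sin (fun s => b * s) s _ _ (is_derive_sin _) h.
by move=> h'; apply: is_derive_eq h' _; ring.
Qed.

Lemma is_derive_gamma_cos (a b t : R) : 0 < t ->
  is_derive t (1 : R) (gamma_cos a b)
    (a * gamma_cos (a - 1) b t - b * gamma_sin (a - 1) b t - gamma_cos a b t).
Proof.
move=> t0.
have := @is_derive_comp_ln (fun s => expR (a * s) * cos (b * s))
  (fun s => expR (a * s) * (- b * sin (b * s)) + cos (b * s) * (a * expR (a * s))) t t0.
move=> /(_ (fun s => is_deriveM (is_derive_expR_mul a s) (is_derive_cos_mul b s))) h.
apply: is_derive_eq h _; rewrite /gamma_cos /gamma_sin mulrBl mul1r expRD; ring.
Qed.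

Lemma is_derive_gamma_sin (a b t : R) : 0 < t ->
  is_derive t (1 : R) (gamma_sin a b)
    (a * gamma_sin (a - 1) b t + b * gamma_cos (a - 1) b t - gamma_sin a b t).
Proof.
move=> t0.
have := @is_derive_comp_ln (fun s => expR (a * s) * sin (b * s))
  (fun s => expR (a * s) * (b * cos (b * s)) + sin (b * s) * (a * expR (a * s))) t t0.
move=> /(_ (fun s => is_deriveM (is_derive_expR_mul a s) (is_derive_sin_mul b s))) h.
apply: is_derive_eq h _; rewrite /gamma_cos /gamma_sin mulrBl mul1r expRD; ring.
Qed.

Lemma continuous_gamma_cos (a b t : R) : 0 < t -> {for t, continuous (gamma_cos a b)}.
Proof.
move=> t0; apply/differentiable_continuous/derivable1_diffP.
exact: (@ex_derive _ _ _ _ _ _ _ (is_derive_gamma_cos a b t0)).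
Qed.

Lemma continuous_gamma_sin (a b t : R) : 0 < t -> {for t, continuous (gamma_sin a b)}.
Proof.
move=> t0; apply/differentiable_continuous/derivable1_diffP.
exact: (@ex_derive _ _ _ _ _ _ _ (is_derive_gamma_sin a b t0)).
Qed.

Lemma gamma_absE (a : R) : gamma_abs a = gamma_cos a 0.
Proof. by apply/funext => t; rewrite /gamma_abs /gamma_cos mul0r cos0 mulr1. Qed.

Lemma mul_ln_le (c : R) :
  exists k : R, 0 <= k /\ forall t, 1 <= t -> c * ln t <= t / 2 + k.
Proof.
(* ln t <= t / s + ln s, with s large enough for c / s <= 1 / 2 *)
pose s := 2 * (`|c| + 1).
have s0 : 0 < s by rewrite mulr_gt0// ltr_wpDl.
have s1 : 1 <= s by rewrite /s; have := normr_ge0 c; lra.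
exists (`|c| * ln s); split; first by rewrite mulr_ge0// ln_ge0.
move=> t t1; have t0 : 0 < t by lra.
have l0 : 0 <= ln t by exact: ln_ge0.
apply: (@le_trans _ _ (`|c| * ln t)); first by rewrite ler_wpM2r// ler_norm.
have h : ln t <= t / s + ln s.
  have {1}-> : t = (t / s) * s by rewrite divfK// gt_eqF.
  by rewrite lnM ?posrE ?divr_gt0// lerD2r ltW// ln_sublinear// divr_gt0.
apply: (@le_trans _ _ (`|c| * (t / s + ln s))); first by rewrite ler_wpM2l.
rewrite mulrDr lerD2r.
rewrite mulrA ler_pdivrMr// /s; have := normr_ge0 c; nra.
Qed.

(** The function a t^(a-1) / (1 + t^a)^2 is the derivative of the bounded
    function 1 - 1/(1 + t^a), and it dominates t^(a-1) e^(-t) at both ends of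
    the half-line. *)
Lemma gamma_abs_integrable (a : R) : 0 < a ->
  leb.-integrable D (EFin \o gamma_abs (a - 1)).
Proof.
move=> a0.
(* expR (a * ln t) is t^a *)
pose F t := 1 - (1 + expR (a * ln t))^-1.
pose f t := a * expR (a * ln t) * t^-1 / (1 + expR (a * ln t)) ^+ 2.
have den t : 0 < 1 + expR (a * ln t) by rewrite ltr_wpDl// expR_gt0.
have dl (t : R) : 0 < t ->
    is_derive t (1 : R) (fun t => 1 + expR (a * ln t)) (a * expR (a * ln t) * t^-1).
  move=> t0.
  have h := @is_derive1_comp R (fun s => expR (a * s)) (@ln R) t _ _
    (is_derive_expR_mul a (ln t)) (is_derive1_ln t0).
  have := @is_deriveD _ _ _ (cst (1 : R)) _ t 1 _ _ (is_derive_cst _ _ _) h.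
  by move=> h'; apply: is_derive_eq h' _; rewrite add0r.
have dF (t : R) : 0 < t -> is_derive t (1 : R) F (f t).
  move=> t0; have n0 : 1 + expR (a * ln t) != 0 by rewrite gt_eqF.
  have h := @is_deriveV R (fun t => 1 + expR (a * ln t)) t _ 1 n0 (dl t t0).
  have := @is_deriveB _ _ _ (cst (1 : R)) _ t 1 _ _ (is_derive_cst _ _ _) h.
  move=> h'; apply: is_derive_eq h' _.
  by rewrite sub0r /GRing.scale/= mulNr opprK /f mulrC.
have cl t : 0 < t -> {for t, continuous (fun t => 1 + expR (a * ln t))}.
  move=> t0; apply/differentiable_continuous/derivable1_diffP.
  exact: (@ex_derive _ _ _ _ _ _ _ (dl t t0)).
have cf t : 0 < t -> {for t, continuous f}.
  move=> t0; have n0 : 1 + expR (a * ln t) != 0 by rewrite gt_eqF.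
  rewrite (_ : f = fun t => a * ((1 + expR (a * ln t)) - 1) * t^-1 /
      ((1 + expR (a * ln t)) * (1 + expR (a * ln t)))); last first.
    by apply/funext => u; rewrite /f expr2 [1 + _ - 1]addrC addKr.
  apply: cvgM.
    apply: cvgM; last by apply: cvgV; [rewrite gt_eqF|exact: cvg_id].
    apply: cvgM; first exact: cvg_cst.
    by apply: cvgB; [exact: cl|exact: cvg_cst].
  apply: cvgV; first by rewrite mulf_neq0.
  by apply: cvgM; exact: cl.
have f0 t : 0 < t -> 0 <= f t.
  by move=> t0; rewrite /f !mulr_ge0 ?invr_ge0 ?exprn_ge0 ?expR_ge0 ?(ltW (den _)) ?ltW.
have FM t : 0 < t -> 0 <= F t <= 1.
  move=> t0; rewrite /F subr_ge0 invf_le1// lerDl expR_ge0/=.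
  by rewrite gerBl invr_ge0 ltW.
have fi := integrable_derive_bounded dF cf f0 FM.
have [k [k0 hk]] := mul_ln_le (2 * a).
have fi2 := integrableZl mD (4 * expR k / a) fi.
apply: le_integrable fi2 => //.
  apply/measurable_EFinP; rewrite gamma_absE; apply: continuous_pos_measurable => t t0.
  exact: continuous_gamma_cos.
move=> t /=; rewrite in_itv/= andbT => t0; rewrite lee_fin.
rewrite !ger0_norm; last 2 first.
  by rewrite mulr_ge0 ?divr_ge0 ?mulr_ge0 ?expR_ge0 ?f0// ltW.
  by rewrite mulr_ge0 ?expR_ge0.
rewrite /gamma_abs /f mulrBl mul1r expRD [expR (- ln t)]expRN lnK ?posrE//.
have -> : 4 * expR k / a * (a * expR (a * ln t) / t / (1 + expR (a * ln t)) ^+ 2) =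
  (expR (a * ln t) / t) * (4 * expR k / (1 + expR (a * ln t)) ^+ 2).
  by field; rewrite !gt_eqF.
apply: ler_wpM2l; first by rewrite divr_ge0 ?expR_ge0// ltW.
rewrite ler_pdivlMr ?exprn_gt0//.
have ek : 1 <= expR k by rewrite -expR0 ler_expR.
have et : expR (- t) <= 1 by rewrite expR_le1; lra.
have e0 := expR_gt0 (- t).
have [t1|t1] := leP t 1.
  have : expR (a * ln t) <= 1 by rewrite expR_le1 pmulr_rle0// ln_le0.
  have := expR_ge0 (a * ln t); move: (expR (a * ln t)) => g g0 g1; nra.
have g1 : 1 <= expR (a * ln t).
  by rewrite -expR0 ler_expR mulr_ge0 ?ln_ge0// ltW.
have g2 : expR (- t) * expR (a * ln t) ^+ 2 <= expR k.
  rewrite -expRM_natl -expRD ler_expR; have := hk t (ltW t1); lra.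
move: (expR (a * ln t)) g1 g2 => g g1 g2; nra.
Qed.

Lemma gamma_cos_integrable (a b : R) : 0 < a ->
  leb.-integrable D (EFin \o gamma_cos (a - 1) b).
Proof.
move=> a0; apply: le_integrable (gamma_abs_integrable a0) => //.
  apply/measurable_EFinP; apply: continuous_pos_measurable => t t0.
  exact: continuous_gamma_cos.
move=> t _ /=; rewrite lee_fin /gamma_cos /gamma_abs !normrM.
rewrite ler_wpM2r// -[leRHS]mulr1 ler_wpM2l//; exact: cos_max.
Qed.

Lemma gamma_sin_integrable (a b : R) : 0 < a ->
  leb.-integrable D (EFin \o gamma_sin (a - 1) b).
Proof.
move=> a0; apply: le_integrable (gamma_abs_integrable a0) => //.
  apply/measurable_EFinP; apply: continuous_pos_measurable => t t0.
  exact: continuous_gamma_sin.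
move=> t _ /=; rewrite lee_fin /gamma_sin /gamma_abs !normrM.
rewrite ler_wpM2r// -[leRHS]mulr1 ler_wpM2l//; exact: sin_max.
Qed.

(** A function dominated by t^a e^(-t) vanishes along the endpoints of the
    intervals K n. *)
Lemma gamma_abs_cvg0 (a : R) (g : R -> R) : 0 < a ->
  (forall t, 0 < t -> `|g t| <= gamma_abs a t) ->
  g n.+1%:R^-1 @[n --> \oo] --> (0 : R) /\ g n.+2%:R @[n --> \oo] --> (0 : R).
Proof.
move=> a0 hg.
have sq (u h : nat -> R) : (forall n, `|u n| <= h n) -> h @ \oo --> (0 : R) ->
    u @ \oo --> (0 : R).
  move=> uh h0; apply: (@squeeze_cvgr _ _ _ _ (fun n => - h n) h) => //.
    by apply: nearW => n; rewrite -ler_norml.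
  by rewrite -oppr0; exact: cvgN.
split.
- apply: (sq _ (fun n => n.+1%:R^-1 `^ a)).
    move=> n; apply: le_trans (hg _ _) _; first by rewrite invr_gt0.
    rewrite /gamma_abs /powR gt_eqF ?invr_gt0// -[leRHS]mulr1.
    by apply: ler_wpM2l; rewrite ?expR_ge0// expR_le1 oppr_le0 invr_ge0.
  have /cvg_at_rightP := powR_cvg0 a0; apply; split.
    by move=> n; rewrite invr_gt0.
  exact: cvg_harmonic.
have [k [k0 hk]] := mul_ln_le a.
apply: (sq _ (fun n => 2 * expR k * n.+1%:R^-1)).
  move=> n; apply: le_trans (hg _ _) _ => //.
  rewrite /gamma_abs -expRD; set t : R := n.+2%:R.
  have t1 : 1 <= t by rewrite ler1n.
  apply: (@le_trans _ _ (expR (k + - (t / 2)))).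
    by rewrite ler_expR; have := hk t t1; lra.
  rewrite expRD [2 * _]mulrC -mulrA ler_wpM2l ?expR_ge0//.
  have th : 0 < t / 2 by lra.
  rewrite expRN; apply: (@le_trans _ _ (t / 2)^-1).
    rewrite lef_pV2 ?posrE ?expR_gt0//; have := expR_ge1Dx (t / 2); lra.
  rewrite invf_div ler_wpM2l// lef_pV2 ?posrE//; last by lra.
rewrite -(mulr0 (2 * expR k)); apply: cvgM; [exact: cvg_cst|exact: cvg_harmonic].
Qed.

Definition gammaC (a b : R) : R := \int[leb]_(t in D) gamma_cos (a - 1) b t.
Definition gammaS (a b : R) : R := \int[leb]_(t in D) gamma_sin (a - 1) b t.

Lemma gammaC_rec (a b : R) : 0 < a ->
  gammaC (a + 1) b = a * gammaC a b - b * gammaS a b.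
Proof.
move=> a0.
have a10 : 0 < a + 1 by lra.
have i1 := integrableZl mD a (gamma_cos_integrable b a0).
have i2 := integrableZl mD b (gamma_sin_integrable b a0).
have := gamma_cos_integrable b a10; rewrite addrK => i3.
have i12 := integrableB mD i1 i2.
have i123 := integrableB mD i12 i3.
rewrite /gammaC /gammaS addrK -!RintegralZl//;
  try exact: gamma_sin_integrable; try exact: gamma_cos_integrable.
rewrite -RintegralB//; apply/eqP; rewrite eq_sym -subr_eq0 -RintegralB//.
have [g0 goo] := gamma_abs_cvg0 (g := gamma_cos a b) a0 ltac:(
  move=> t t0; rewrite /gamma_cos /gamma_abs !normrM !(ger0_norm (expR_ge0 _));
  rewrite ler_wpM2r ?expR_ge0// -[leRHS]mulr1 ler_wpM2l ?expR_ge0//; exact: cos_max).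
apply/eqP; apply: (integral_derive_eq0 (F := gamma_cos a b)) => //.
- by move=> t t0; exact: is_derive_gamma_cos.
- move=> t t0; apply: cvgB; last exact: continuous_gamma_cos.
  apply: cvgB; apply: cvgM; try exact: cvg_cst.
    exact: continuous_gamma_cos.
  exact: continuous_gamma_sin.
Qed.

Lemma gammaS_rec (a b : R) : 0 < a ->
  gammaS (a + 1) b = a * gammaS a b + b * gammaC a b.
Proof.
move=> a0.
have a10 : 0 < a + 1 by lra.
have i1 := integrableZl mD a (gamma_sin_integrable b a0).
have i2 := integrableZl mD b (gamma_cos_integrable b a0).
have := gamma_sin_integrable b a10; rewrite addrK => i3.
have i12 := integrableD mD i1 i2.
have i123 := integrableB mD i12 i3.
rewrite /gammaC /gammaS addrK -!RintegralZl//;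
  try exact: gamma_sin_integrable; try exact: gamma_cos_integrable.
rewrite -RintegralD//; apply/eqP; rewrite eq_sym -subr_eq0 -RintegralB//.
have [g0 goo] := gamma_abs_cvg0 (g := gamma_sin a b) a0 ltac:(
  move=> t t0; rewrite /gamma_sin /gamma_abs !normrM !(ger0_norm (expR_ge0 _));
  rewrite ler_wpM2r ?expR_ge0// -[leRHS]mulr1 ler_wpM2l ?expR_ge0//; exact: sin_max).
apply/eqP; apply: (integral_derive_eq0 (F := gamma_sin a b)) => //.
- by move=> t t0; exact: is_derive_gamma_sin.
- move=> t t0; apply: cvgB; last exact: continuous_gamma_sin.
  apply: cvgD; apply: cvgM; try exact: cvg_cst.
    exact: continuous_gamma_sin.
  exact: continuous_gamma_cos.
Qed.

Lemma cGammaE (a b : R) : cGamma (a +i* b) = gammaC a b +i* gammaS a b.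
Proof.
rewrite /cGamma /cintegral /gammaC /gammaS.
by apply/eqP; rewrite eq_complex /=; apply/andP; split; apply/eqP;
  apply: eq_Rintegral => t _; rewrite /gamma_cos /gamma_sin /cpow /cexp /=
    ?oppr0 ?mulr0 ?addr0 ?subr0 ?mul0r ?add0r.
Qed.

Lemma gammaS0 (a : R) : gammaS a 0 = 0.
Proof.
rewrite /gammaS (@eq_Rintegral _ _ _ _ _ (cst 0)); last first.
  by move=> y _; rewrite /gamma_sin mul0r sin0 mulr0 mul0r.
by rewrite Rintegral_cst ?mul0r.
Qed.

Lemma gammaC0_ge0 (a : R) : 0 <= gammaC a 0.
Proof.
by apply: Rintegral_ge0 => t _; rewrite -gamma_absE /gamma_abs mulr_ge0 ?expR_ge0.
Qed.

Lemma gamma_norm_le (a b : R) : 0 < a ->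
  gammaC a b ^+ 2 + gammaS a b ^+ 2 <= gammaC a 0 ^+ 2.
Proof.
move=> a0; apply: Rintegral_norm2_le => //.
- exact: gamma_cos_integrable.
- exact: gamma_sin_integrable.
- exact: gamma_cos_integrable.
- by move=> t _; rewrite -gamma_absE /gamma_abs mulr_ge0 ?expR_ge0.
move=> t _; rewrite -gamma_absE /gamma_cos /gamma_sin /gamma_abs.
have := cos2Dsin2 (b * ln t) => h.
rewrite !exprMn -[X in _ <= X * _]mulr1 -h; lra.
Qed.

End gamma.

(** * Complex moments of a random variable *)

Section moments.
Context (R : realType) (d : measure_display) (T : measurableType d).
Context (P : probability T R) (Y : {RV P >-> R}).
Context (intY : forall s : R, 0 < s ->
  P.-integrable setT (fun t => (Y t `^ (s - 1))%:E)).

Let L (t : T) : R := ln (Y t).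
(** With momS, the real and imaginary parts of E[Y^(s-1+ib)]. Powers are
    written as exponentials of ln Y, which is also meaningful, with value 1,
    where Y = 0. *)
Definition momC (s b : R) : R :=
  \int[P]_(t in setT) (expR ((s - 1) * ln (Y t)) * cos (b * ln (Y t))).
Definition momS (s b : R) : R :=
  \int[P]_(t in setT) (expR ((s - 1) * ln (Y t)) * sin (b * ln (Y t))).

Let mL : measurable_fun setT L.
Proof. by apply: measurableT_comp; [exact: measurable_ln|exact: measurable_funPT]. Qed.

Let mE (c : R) : measurable_fun setT (fun t => expR (c * L t)).
Proof.
apply: measurableT_comp; first exact: measurable_expR.
by apply: measurable_funM => //; exact: measurable_cst.
Qed.

Lemma mom_integrable (s : R) : 0 < s ->
  P.-integrable setT (EFin \o (fun t => expR ((s - 1) * ln (Y t)))).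
Proof.
move=> s0.
have i1 : P.-integrable setT (EFin \o cst (1 : R)) by exact: finite_measure_integrable_cst.
have := integrableD measurableT (intY s0) i1.
apply: le_integrable => //; first by apply/measurable_EFinP; exact: mE.
move=> t _ /=; rewrite lee_fin !ger0_norm ?addr_ge0 ?powR_ge0 ?expR_ge0//.
rewrite /powR; case: ifPn => [/eqP ->|Yn0]; last by rewrite lerDl.
by rewrite ln0// mulr0 expR0 lerDr.
Qed.

Lemma momC_integrable (s b : R) : 0 < s ->
  P.-integrable setT (EFin \o (fun t => expR ((s - 1) * ln (Y t)) * cos (b * ln (Y t)))).
Proof.
move=> s0; apply: le_integrable (mom_integrable s0) => //.
  apply/measurable_EFinP; apply: measurable_funM; first exact: mE.
  apply: measurableT_comp; first by apply: continuous_measurable_fun; exact: continuous_cos.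
  by apply: measurable_funM => //; exact: measurable_cst.
move=> t _ /=; rewrite lee_fin normrM -[leRHS]mulr1 ler_wpM2l//; exact: cos_max.
Qed.

Lemma momS_integrable (s b : R) : 0 < s ->
  P.-integrable setT (EFin \o (fun t => expR ((s - 1) * ln (Y t)) * sin (b * ln (Y t)))).
Proof.
move=> s0; apply: le_integrable (mom_integrable s0) => //.
  apply/measurable_EFinP; apply: measurable_funM; first exact: mE.
  apply: measurableT_comp; first by apply: continuous_measurable_fun; exact: continuous_sin.
  by apply: measurable_funM => //; exact: measurable_cst.
move=> t _ /=; rewrite lee_fin normrM -[leRHS]mulr1 ler_wpM2l//; exact: sin_max.
Qed.

Lemma momC0E (s : R) : momC s 0 = \int[P]_(t in setT) expR ((s - 1) * ln (Y t)).
Proof. by apply: eq_Rintegral => t _; rewrite mul0r cos0 mulr1. Qed.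

Lemma momS0 (s : R) : momS s 0 = 0.
Proof.
rewrite /momS (@eq_Rintegral _ _ _ _ _ (cst 0)); last first.
  by move=> y _; rewrite mul0r sin0 mulr0.
by rewrite Rintegral_cst ?mul0r.
Qed.

Lemma momC0_gt0 (s : R) : 0 < s -> 0 < momC s 0.
Proof.
move=> s0; rewrite momC0E lt_neqAle; apply/andP; split; last first.
  by apply: Rintegral_ge0 => t _; exact: expR_ge0.
apply/eqP => h0.
have fi := mom_integrable s0.
have h1 : (\int[P]_(t in setT) `|(EFin \o (fun t => expR ((s - 1) * ln (Y t)))) t| = 0)%E.
  rewrite (_ : integral _ _ _ =
      (\int[P]_(t in setT) (expR ((s - 1) * ln (Y t)))%:E)%E); last first.
    by apply: eq_integral => t _ /=; rewrite ger0_norm ?expR_ge0.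
  by rewrite -(fineK (integrable_fin_num measurableT fi)) -/(Rintegral _ _ _) -h0.
have /(ae_eq_integral_abs _ measurableT (measurable_int _ fi)) [N [mN PN0 hN]] := h1.
have : P setT = 0%E.
  apply/eqP; rewrite -measure_le0 -PN0; apply: le_measure; rewrite ?inE// => t _.
  apply: hN => /= /(_ Logic.I) [] /eqP; by rewrite gt_eqF// expR_gt0.
by rewrite probability_setT => /eqP; rewrite onee_eq0.
Qed.

(** Tilt the law by Y^(s-1) and put u = Y / m. The modulus of the mean of
    u^(ib) is at least its real part, the mean of cos (b ln u) >= 1 - C (u -
    1)^2, and expanding the square leaves the moments s, s + 1 and s + 2. *)
Lemma mom_norm_ge (s b m : R) : 0 < s -> 0 < m ->
  momC s 0 - (2 * b ^+ 2 + 8) *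
    (momC (s + 2) 0 / m ^+ 2 - 2 * (momC (s + 1) 0 / m) + momC s 0) <=
  Num.sqrt (momC s b ^+ 2 + momS s b ^+ 2).
Proof.
move=> s0 m0; set th := b * ln m; set C := 2 * b ^+ 2 + 8.
have s10 : 0 < s + 1 by lra.
have s20 : 0 < s + 2 by lra.
apply: (@le_trans _ _ (cos th * momC s b + sin th * momS s b)); last first.
  set X := momC s b; set Z := momS s b.
  have h : (cos th * X + sin th * Z) ^+ 2 <= X ^+ 2 + Z ^+ 2.
    have := cos2Dsin2 th; have := sqr_ge0 (cos th * Z - sin th * X).
    move: (cos th) (sin th) => c n h1 h2.
    rewrite -[leRHS]mul1r -h2; lra.
  by apply: le_trans (ler_norm _) _; rewrite -sqrtr_sqr ler_sqrt// addr_ge0 ?sqr_ge0.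
have iC := integrableZl measurableT (cos th) (momC_integrable b s0).
have iS := integrableZl measurableT (sin th) (momS_integrable b s0).
have i0 := mom_integrable s0; have i1 := mom_integrable s10; have i2 := mom_integrable s20.
have j2 := integrableZl measurableT (C * m ^- 2) i2.
have j1 := integrableZl measurableT (2 * C / m) i1.
have j0 := integrableZl measurableT (1 - C) i0.
have jB := integrableB measurableT j1 j2.
have jD := integrableD measurableT j0 jB.
have hC := RintegralZl (cos th) measurableT (momC_integrable b s0).
have hS := RintegralZl (sin th) measurableT (momS_integrable b s0).
rewrite [leRHS](_ : _ = \int[P]_(t in setT)
    (cos th * (expR ((s - 1) * ln (Y t)) * cos (b * ln (Y t))) +
     sin th * (expR ((s - 1) * ln (Y t)) * sin (b * ln (Y t))))); last first.
  by rewrite RintegralD// hC hS.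
rewrite !momC0E.
rewrite [leLHS](_ : _ = \int[P]_(t in setT) ((1 - C) * expR ((s - 1) * ln (Y t)) +
   ((2 * C / m) * expR ((s + 1 - 1) * ln (Y t)) -
    (C * m ^- 2) * expR ((s + 2 - 1) * ln (Y t))))); last first.
  rewrite (RintegralD measurableT j0 jB) (RintegralB measurableT j1 j2).
  rewrite (RintegralZl _ measurableT i0) (RintegralZl _ measurableT i1).
  by rewrite (RintegralZl _ measurableT i2); field; rewrite gt_eqF.
apply: le_Rintegral => //; first exact: (integrableD measurableT iC iS).
move=> t _.
(* u is Y / m where Y > 0, and positive everywhere *)
pose u := expR (ln (Y t) - ln m).
have uE : expR (ln (Y t)) = u * m by rewrite /u expRB [expR (ln m)]lnK ?posrE// divfK// gt_eqF.
have := @onem_cos_ln_le R b u (expR_gt0 _); rewrite -/C /u expRK mulrBr cosB -/th -/u => hu.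
have -> : expR ((s + 1 - 1) * ln (Y t)) = expR ((s - 1) * ln (Y t)) * (u * m).
  by rewrite -uE -expRD; congr expR; ring.
have -> : expR ((s + 2 - 1) * ln (Y t)) = expR ((s - 1) * ln (Y t)) * (u * m) ^+ 2.
  by rewrite -uE -expRM_natl -expRD; congr expR; ring.
have e0 := expR_gt0 ((s - 1) * ln (Y t)); move: (expR ((s - 1) * ln (Y t))) e0 => E E0.
move: hu; move: (cos th) (sin th) (cos _) (sin _) => c n c' n' hu.
rewrite [leLHS](_ : _ = E * (1 - C * (u - 1) ^+ 2)); last by field; rewrite gt_eqF.
rewrite [leRHS](_ : _ = E * (c' * c + n' * n)); last by ring.
by rewrite ler_pM2l//; lra.
Qed.

End moments.

Lemma cintegral_cpowE d (T : measurableType d) (R : realType) (P : probability T R)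
    (Y : {RV P >-> R}) (s b : R) :
  cintegral P setT (fun t => cpow (Y t) ((s +i* b) - 1)) =
  momC Y s b +i* momS Y s b.
Proof.
rewrite /cintegral /momC /momS.
by apply/eqP; rewrite eq_complex /=; apply/andP; split; apply/eqP;
  apply: eq_Rintegral => t _; rewrite /cpow /cexp /= ?oppr0 ?mulr0 ?addr0 ?subr0 ?add0r.
Qed.

(** * Exponential decay of Gamma over the Bernstein-gamma function *)

Lemma add1_complex (R : realType) (a b : R) : (a +i* b) + 1 = (a + 1) +i* b.
Proof. by apply/eqP; rewrite eq_complex/= addr0 !eqxx. Qed.

(** Iterated functional equation, used for Gamma with f = id and for W with f
    = phi, both on the line and on the real axis. *)
Lemma normc_shift (R : realType) (F f : R[i] -> R[i]) (a b : R) (n : nat) :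
  (forall z : R[i], 0 < complex.Re z -> F (z + 1) = f z * F z) -> 0 < a ->
  Normc.normc (F ((a + n%:R) +i* b)) =
  (\prod_(k < n) Normc.normc (f ((a + k%:R) +i* b))) * Normc.normc (F (a +i* b)).
Proof.
move=> Ff a0; elim: n => [|n IH]; first by rewrite big_ord0 mul1r addr0.
rewrite big_ord_recr/= mulrAC -IH -natr1 addrA -add1_complex Ff.
  by rewrite Normc.normcM mulrC.
by rewrite /= ltr_wpDr.
Qed.

Lemma cGamma_succ (R : realType) (z : R[i]) : 0 < complex.Re z ->
  cGamma (z + 1) = z * cGamma z.
Proof.
case: z => a b /= a0; rewrite add1_complex !cGammaE gammaC_rec// gammaS_rec//.
Qed.

Lemma cGamma_norm_le (R : realType) (a b : R) : 0 < a ->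
  Normc.normc (cGamma (a +i* b)) <= Normc.normc (cGamma (a +i* 0)).
Proof.
move=> a0; rewrite !cGammaE gammaS0 [leRHS]normc_real ?gammaC0_ge0//.
by apply: normc_le; [exact: gammaC0_ge0|exact: gamma_norm_le].
Qed.

(** The functional equation moves both sides to a + n, where |Gamma(z)| <=
    Gamma(Re z). *)
Lemma cGamma_prod_le (R : realType) (a b : R) (n : nat) : 0 < a ->
  (\prod_(k < n) Normc.normc ((a + k%:R) +i* b)) * Normc.normc (cGamma (a +i* b)) <=
  (\prod_(k < n) (a + k%:R)) * Normc.normc (cGamma (a +i* 0)).
Proof.
move=> a0; rewrite -(@normc_shift R (@cGamma R) id)//; last exact: cGamma_succ.
rewrite (eq_bigr (fun k : 'I_n => Normc.normc ((a + k%:R) +i* 0))); last first.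
  by move=> k _; rewrite normc_real// ltW// ltr_wpDr.
rewrite -(@normc_shift R (@cGamma R) id)//; last exact: cGamma_succ.
by apply: cGamma_norm_le; rewrite ltr_wpDr.
Qed.

(** Since 1 + u <= e^u, the bound K e^(-eta |b|) is below K / (eta |b|). *)
Lemma cvg_exp_decay (R : realType) (h : R -> R) (K eta B : R) : 0 < K -> 0 < eta ->
  (forall b, 0 <= h b) -> (forall b, B <= `|b| -> h b <= K * expR (- (eta * `|b|))) ->
  h b @[b --> +oo%R] --> (0 : R) /\ h b @[b --> -oo%R] --> (0 : R).
Proof.
move=> K0 eta0 h0 hB.
have main e : 0 < e -> exists M : R, 0 < M /\ forall b, M <= `|b| -> `|0 - h b| <= e.
  move=> e0; exists (Num.max (Num.max B 1) (K / (eta * e))); split.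
    by rewrite !lt_max ltr01 orbT.
  move=> b; rewrite !ge_max => /andP[/andP[bB b1] bK].
  rewrite sub0r normrN ger0_norm//; apply: le_trans (hB b bB) _.
  have x0 : 0 < eta * `|b| by rewrite mulr_gt0//; apply: lt_le_trans b1.
  apply: (@le_trans _ _ (K * (eta * `|b|)^-1)).
    rewrite ler_pM2l// expRN lef_pV2 ?posrE ?expR_gt0//.
    by have := expR_ge1Dx (eta * `|b|); lra.
  rewrite ler_pdivrMr//; move: bK; rewrite ler_pdivrMr ?mulr_gt0//.
  by rewrite mulrA [`|b| * eta]mulrC [_ * e]mulrC.
split; apply/cvgrPdist_le => e e0; have [M [M0 hM]] := main e e0.
  near=> b; apply: hM; apply: le_trans (ler_norm _).
  by near: b; apply: nbhs_pinfty_ge; exact: num_real.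
near=> b; apply: hM; rewrite -normrN; apply: le_trans (ler_norm _).
rewrite lerNr; near: b; apply: nbhs_ninfty_le; exact: num_real.
Unshelve. all: end_near. Qed.

Section ratio.
Context (R : realType) (phi W : R[i] -> R[i]) (p : R -> R).
Context (phi_real : forall t, 0 < t -> phi (t +i* 0) = p t +i* 0).
Context (p_gt0 : forall t, 0 < t -> 0 < p t).
Context (p_succ : forall t, 0 < t -> p (t + 1) <= (1 + t^-1) * p t).
Context (phi_norm_gt0 : forall t b, 0 < t -> 0 < Normc.normc (phi (t +i* b))).
Context (ratio_le : forall t b, 0 < t ->
  Normc.normc (phi (t +i* b)) * t <= Normc.normc (t +i* b) * p t).
Context (delta B : R) (delta_gt0 : 0 < delta) (delta_lt1 : delta < 1) (B_gt0 : 0 < B).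
Context (ratio_lt : forall t b, B <= `|b| -> `|b| <= t -> t <= 3 * `|b| ->
  Normc.normc (phi (t +i* b)) * t <= (1 - delta) * (Normc.normc (t +i* b) * p t)).
Context (HW : is_bernstein_gamma phi W).

Lemma W_real_gt0 (s : R) : 0 < s -> 0 < Normc.normc (W (s +i* 0)).
Proof.
case: HW => _ _ [d [T [P [Y [_ _ HY]]]]] s0.
have intY s' : 0 < s' -> P.-integrable setT (fun t => (Y t `^ (s' - 1))%:E).
  by move=> s'0; have [] := HY (s' +i* 0) s'0.
have [_ ->] := HY (s +i* 0) s0; rewrite cintegral_cpowE momS0 normc_real.
  exact: momC0_gt0.
by apply: ltW; exact: momC0_gt0.
Qed.

(** The choice m = phi(s) makes the tilted variable Y / m have mean 1 and
    variance phi(s+1)/phi(s) - 1 <= 1/s. *)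
Lemma W_norm_ge (s b : R) : 0 < s ->
  Normc.normc (W (s +i* 0)) * (1 - (2 * b ^+ 2 + 8) / s) <= Normc.normc (W (s +i* b)).
Proof.
move=> s0; case: HW => _ Wrec [d [T [P [Y [_ _ HY]]]]].
have intY s' : 0 < s' -> P.-integrable setT (fun t => (Y t `^ (s' - 1))%:E).
  by move=> s'0; have [] := HY (s' +i* 0) s'0.
have WE s' b' : 0 < s' -> W (s' +i* b') = momC Y s' b' +i* momS Y s' b'.
  by move=> s'0; have [_ ->] := HY (s' +i* b') s'0; rewrite cintegral_cpowE.
have rec s' : 0 < s' -> momC Y (s' + 1) 0 = p s' * momC Y s' 0.
  move=> s'0; have := Wrec (s' +i* 0) s'0.
  rewrite add1_complex phi_real// !WE//; last by rewrite ltr_wpDr.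
  rewrite !momS0 => /eqP; rewrite eq_complex/= => /andP[/eqP -> _].
  by rewrite !mulr0 subr0.
have M0 := momC0_gt0 intY s0.
have s10 : 0 < s + 1 by lra.
have ps := p_gt0 s0.
rewrite [leRHS]/Normc.normc WE// [leRHS]/= WE// momS0 normc_real ?(ltW M0)//.
apply: le_trans (mom_norm_ge intY b s0 ps).
rewrite (_ : s + 2 = s + 1 + 1); last by ring.
rewrite !rec// mulrBr mulr1 lerD2l lerN2.
have -> : p (s + 1) * (p s * momC Y s 0) / p s ^+ 2 - 2 * (p s * momC Y s 0 / p s) +
  momC Y s 0 = momC Y s 0 * (p (s + 1) / p s - 1) by field; rewrite gt_eqF.
rewrite [leRHS]mulrCA; apply: ler_wpM2l.
  by rewrite addr_ge0// mulr_ge0// sqr_ge0.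
by rewrite ler_pM2l// lerBlDr ler_pdivrMr// [s^-1 + 1]addrC p_succ.
Qed.

(** Of the factors r k, those with N < k <= 2N have |b| <= a + k <= 3|b| and
    contribute 1 - delta each; the remaining ones are at most 1. The factor 2
    is the loss in the lower bound on W at a + n. *)
Lemma gamma_W_ratio_le (a b : R) (N : nat) : 0 < a -> a <= `|b| -> B <= `|b| ->
  N%:R <= `|b| -> `|b| < N.+1%:R ->
  Normc.normc (cGamma (a +i* b) / W (a +i* b)) <=
  2 * Normc.normc (cGamma (a +i* 0)) / Normc.normc (W (a +i* 0)) * (1 - delta) ^+ N.
Proof.
move=> a0 ab Bb Nb bN.
have Wrec z : 0 < complex.Re z -> W (z + 1) = phi z * W z by case: HW => _ + _; exact.
set C := 2 * b ^+ 2 + 8.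
have C0 : 0 < C by rewrite /C; have := sqr_ge0 b; lra.
(* Large enough to contain the indices up to 2N and to make C / (a + n) <= 1/2. *)
pose n := maxn N.*2.+1 (Num.bound (2 * C)).
have an0 : 0 < a + n%:R by rewrite ltr_wpDr.
have nC : C / (a + n%:R) <= 1 / 2.
  rewrite ler_pdivrMr//.
  have h1 : 2 * C < (Num.bound (2 * C))%:R by apply: archi_boundP; lra.
  have h2 : (Num.bound (2 * C))%:R <= n%:R :> R by rewrite ler_nat leq_maxr.
  lra.
set Z := fun k : nat => Normc.normc ((a + k%:R) +i* b).
set Nk := fun k : nat => Normc.normc (phi ((a + k%:R) +i* b)).
have ak0 k : 0 < a + k%:R by rewrite ltr_wpDr.
have Z0 k : 0 < Z k.
  by rewrite /Z normc_pairE sqrtr_gt0 ltr_pwDl ?exprn_gt0// sqr_ge0.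
have Nk0 k : 0 < Nk k by exact: phi_norm_gt0.
pose r k := (a + k%:R) / Z k * (Nk k / p (a + k%:R)).
have r_ge0 k : 0 <= r k.
  by rewrite ltW// /r mulr_gt0 ?divr_gt0 ?p_gt0.
have rE k : r k = Nk k * (a + k%:R) / (Z k * p (a + k%:R)).
  by rewrite /r; field; rewrite !gt_eqF// p_gt0.
pose c k : R := if (N < k <= N.*2)%N then 1 - delta else 1.
have rc k : r k <= c k.
  rewrite rE /c ler_pdivrMr ?mulr_gt0 ?p_gt0//; case: ifP => [/andP[k1 k2]|_].
    apply: ratio_lt => //.
      have : N.+1%:R <= k%:R :> R by rewrite ler_nat.
      lra.
    have : k%:R <= N.*2%:R :> R by rewrite ler_nat.
    by rewrite -muln2 natrM; lra.
  by rewrite mul1r ratio_le.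
have prodc : \prod_(k < n) c k = (1 - delta) ^+ N.
  rewrite -(big_mkord xpredT c) (@big_cat_nat _ _ _ N.+1)//=; last first.
    by rewrite leq_max ltnS -addnn leq_addr.
  rewrite (@big_cat_nat _ _ _ N.*2.+1 N.+1)//=;
    [|by rewrite ltnS -addnn leq_addr|by rewrite leq_maxl].
  rewrite [X in X * _]big1_seq; last first.
    move=> k /=; rewrite mem_index_iota ltnS /c => /andP[_ kN].
    by rewrite ltnNge kN.
  rewrite [X in _ * (_ * X)]big1_seq; last first.
    move=> k /=; rewrite mem_index_iota /c => /andP[kN _].
    by rewrite [(k <= _)%N]leqNgt kN andbF.
  rewrite mul1r mulr1 (@eq_big_seq _ _ _ _ _ c (fun=> 1 - delta)); last first.
    by move=> k; rewrite mem_index_iota ltnS /c => ->.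
  by rewrite prodr_const_nat subSS -addnn addnK.
have prodr : \prod_(k < n) r k <= (1 - delta) ^+ N.
  by rewrite -prodc; apply: ler_prod => k _; rewrite r_ge0 rc.
have hG := cGamma_prod_le b n a0.
have hW : (\prod_(k < n) p (a + k%:R)) * Normc.normc (W (a +i* 0)) <=
    2 * ((\prod_(k < n) Nk k) * Normc.normc (W (a +i* b))).
  rewrite -(normc_shift b n Wrec a0).
  have -> : \prod_(k < n) p (a + k%:R) =
      \prod_(k < n) Normc.normc (phi ((a + k%:R) +i* 0)).
    by apply: eq_bigr => k _; rewrite phi_real// normc_real// ltW// p_gt0.
  rewrite -(normc_shift 0 n Wrec a0).
  have := W_norm_ge b an0; rewrite -/C.
  have := normc_ge0 (W ((a + n%:R) +i* 0)).
  move: (Normc.normc (W _)) (Normc.normc (W _)) => M M' M0 h.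
  nra.
have PZ : 0 < \prod_(k < n) Z k by apply: prodr_gt0.
have PN : 0 < \prod_(k < n) Nk k by apply: prodr_gt0.
have Pp : 0 < \prod_(k < n) p (a + k%:R) by apply: prodr_gt0 => k _; exact: p_gt0.
have Pa : 0 < \prod_(k < n) (a + k%:R) by apply: prodr_gt0.
have prE : \prod_(k < n) r k = (\prod_(k < n) (a + k%:R)) / (\prod_(k < n) Z k) *
    ((\prod_(k < n) Nk k) / (\prod_(k < n) p (a + k%:R))).
  by rewrite /r !big_split/= !prodfV.
have Wa := W_real_gt0 a0.
rewrite Normc.normcM Normc.normcV.
have Wb : 0 < Normc.normc (W (a +i* b)).
  rewrite lt_neqAle normc_ge0 andbT; apply/eqP => W0; move: hW; rewrite -W0 !mulr0.
  by rewrite leNgt mulr_gt0.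
have G0 := normc_ge0 (cGamma (a +i* 0)).
have g0 := normc_ge0 (cGamma (a +i* b)).
apply: (@le_trans _ _ (2 * Normc.normc (cGamma (a +i* 0)) /
    Normc.normc (W (a +i* 0)) * \prod_(k < n) r k)); last first.
  by rewrite ler_wpM2l// divr_ge0 ?mulr_ge0// ltW.
move: hG hW; rewrite prE -/(Z _).
rewrite (_ : \prod_(k < n) Normc.normc ((a + k%:R) +i* b) = \prod_(k < n) Z k)//.
move: PZ PN Pp Pa Wa Wb G0 g0; move: (\prod_(k < n) Z k) (\prod_(k < n) Nk k)
  (\prod_(k < n) p (a + k%:R)) (\prod_(k < n) (a + k%:R)).
move: (Normc.normc _) (Normc.normc _) (Normc.normc _) (Normc.normc _).
move=> g G w V PZ PN Pp Pa PZ0 PN0 Pp0 Pa0 V0 w0 G0 g0 hG hW.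
have h1 : g <= Pa * G / PZ by rewrite ler_pdivlMr// mulrC.
have h2 : w^-1 <= 2 * PN / (Pp * V).
  rewrite -[leRHS]invrK lef_pV2 ?posrE ?invr_gt0 ?divr_gt0 ?mulr_gt0//.
  by rewrite invf_div ler_pdivrMr ?mulr_gt0//; lra.
apply: (@le_trans _ _ (Pa * G / PZ * (2 * PN / (Pp * V)))).
  by apply: ler_pM => //; rewrite invr_ge0 ltW.
by rewrite le_eqVlt; apply/orP; left; apply/eqP; field; rewrite !gt_eqF.
Qed.

Lemma gamma_W_cvg0 (eps a eta : R) : eps <= delta -> 0 < a -> 0 < eta -> eta < eps ->
  let g (b : R) : R := expR ((eps - eta) * `|b|) *
    Normc.normc (cGamma (a +i* b) / W (a +i* b)) in
  g b @[b --> +oo%R] --> (0 : R) /\ g b @[b --> -oo%R] --> (0 : R).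
Proof.
move=> ed a0 eta0 etae g.
pose K0 := 2 * Normc.normc (cGamma (a +i* 0)) / Normc.normc (W (a +i* 0)).
have K00 : 0 <= K0 by rewrite /K0 divr_ge0 ?mulr_ge0 ?normc_ge0.
apply: (@cvg_exp_decay _ g ((K0 + 1) * expR delta) eta (Num.max a B)) => //.
- by rewrite mulr_gt0 ?expR_gt0//; lra.
- by move=> b; rewrite /g mulr_ge0 ?expR_ge0 ?normc_ge0.
move=> b; rewrite ge_max => /andP[ab Bb].
have /andP[Nb bN] := truncn_itv (normr_ge0 b).
have := gamma_W_ratio_le a0 ab Bb Nb bN; rewrite -/K0 /g.
move: (Num.truncn `|b|) Nb bN => N Nb bN h.
have hd : (1 - delta) ^+ N <= expR (delta - delta * `|b|).
  apply: (@le_trans _ _ (expR (- delta) ^+ N)).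
    have d0 : 0 <= 1 - delta by rewrite subr_ge0 ltW.
    have de : 1 - delta <= expR (- delta) by exact: expR_ge1Dx.
    by rewrite lerXn2r ?nnegrE ?expR_ge0.
  rewrite -expRM_natl ler_expR; move: bN; rewrite -natr1 => bN; nra.
apply: (@le_trans _ _ (expR ((eps - eta) * `|b|) * (K0 * expR (delta - delta * `|b|)))).
  rewrite ler_wpM2l ?expR_ge0//; apply: le_trans h _; exact: ler_wpM2l.
rewrite mulrCA -expRD -[leRHS]mulrA -expRD; apply: ler_pM; rewrite ?expR_ge0//.
  by lra.
rewrite ler_expR; have := normr_ge0 b; nra.
Qed.
End ratio.

(** * The two sufficient conditions *)

(** Both assertions use only the behaviour of mu near 0, so the two cases of
    the corollary meet here. *)
Lemma conclusion_of_small_jumps (R : realType) (q x0 C rho : R)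
    (mu : {measure set (measurableTypeR R) -> \bar R}) :
  levy_measure mu -> not_identically_zero (laplace_exponent q 0 mu) ->
  0 <= q -> 0 < x0 -> 0 < C -> rho < 1 ->
  (forall x, 0 < x -> x < x0 -> 0 < levy_tail mu x) ->
  (forall x, 0 < x -> x < x0 -> levy_min mu x <= C * (x * levy_tail mu x)) ->
  (forall x, 0 < x -> x < x0 -> levy_tail mu (2 * x) <= rho * levy_tail mu x) ->
  exists eps : R, 0 < eps /\
      (exists a0 b0 : R, [/\ 0 < a0, 0 < b0 &
         forall a b : R, a0 <= a -> b0 * a <= `|b| ->
           eps * `|b| - eps * b0 * a <=
           A_fun (phi_star (laplace_exponent q 0 mu)) a b]) /\
      B_exp eps (laplace_exponent q 0 mu).
Proof.
move=> hmu hphi q0 x00 C0 rho1 tail_gt0 min_le tail_dbl.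
have [e1 [a0 [e10 a00 hA]]] := A_fun_ge hmu q0 x00 C0 rho1 tail_gt0 min_le tail_dbl.
have [delta [B [d0 d1 B0 hlt]]] := exponent_ratio_lt hmu q0 x00 C0 tail_gt0 min_le.
have e0 : 0 < Num.min e1 delta by rewrite lt_min e10.
exists (Num.min e1 delta); split => //; split.
  exists a0, 1; split => // a b a0a; rewrite mul1r mulr1 -mulrBr => ab.
  by apply: hA => //; [exact: ltW|rewrite ge_min lexx].
split => //.
  by exists q, 0, mu; split.
move=> W HW a eta a_gt0 eta0 etae.
have Upos t : 0 < t -> 0 < q + phi_re mu t 0.
  by move=> t0; rewrite ltr_wpDl// (phi_re0_gt0 hmu x00 tail_gt0).
apply: (@gamma_W_cvg0 R (laplace_exponent q 0 mu) W
  (fun t => q + phi_re mu t 0) _ _ _ _ _ delta B) => //.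
- by move=> t t0; rewrite laplace_exponentE phi_im0.
- move=> t t0; rewrite mulrDr; apply: lerD; last exact: phi_re0_succ.
  by rewrite mulrDl mul1r lerDl mulr_ge0// invr_ge0 ltW.
- move=> t b t0; rewrite laplace_exponentE normc_pairE sqrtr_gt0.
  exact: (phi_den_gt0 hmu q0 x00 tail_gt0).
- by move=> t b t0; exact: exponent_ratio_le.
- by rewrite ge_min lexx orbT.
Qed.

Theorem corollary5p5 (R : realType) (q d : R)
    (mu : {measure set (measurableTypeR R) -> \bar R})
    (hq : 0 <= q) (hd : d = 0) (hmu : levy_measure mu)
    (hphi : not_identically_zero (laplace_exponent q d mu)) :
  let phi := laplace_exponent q d mu in
  let conclusion :=
    exists eps : R, 0 < eps /\
      (exists a0 b0 : R, [/\ 0 < a0, 0 < b0 &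
         forall a b : R, a0 <= a -> b0 * a <= `|b| ->
           eps * `|b| - eps * b0 * a <= A_fun (phi_star phi) a b]) /\
      B_exp eps phi in
  (positive_increase mu ->
   (limf_esup (fun x : R => (levy_tail mu (2 * x) / levy_tail mu x)%:E) 0^'+
      < 1)%E ->
   conclusion) /\
  (forall (alpha : R) (l : R -> R),
     0 < alpha -> alpha < 1 -> slowly_varying_at0 l ->
     levy_tail mu y / (y `^ (- alpha) * l y) @[y --> 0^'+] --> (1 : R) ->
   conclusion).
Proof.
subst d => phi conclusion; split.
  move=> /(positive_increase_small_jumps hmu)[C [x1 [C0 x10 h1]]].
  move=> /lt_limf_esup_near[rho [x2 [rho1 x20 h2]]].
  have x0 : 0 < Num.min x1 x2 by rewrite lt_min x10.
  apply: (conclusion_of_small_jumps hmu hphi hq x0 C0 rho1) => x xp;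
    rewrite lt_min => /andP[xx1 xx2]; have [t0 m0] := h1 x xp xx1 => //.
  by rewrite -ler_pdivrMr// h2.
move=> alpha l al0 al1 hl hr.
have [[x1 x10 t0] cv] := regular_variation_ratio hl hr.
have /andP[p1 p2] := half_lt_powR2N al0 al1.
(* Thresholds strictly between 1/2, 2^(-alpha) and 1. *)
pose kappa := (1 / 2 + 2 `^ (- alpha)) / 2.
pose rho := (1 + 2 `^ (- alpha)) / 2.
have k1 : 1 < 2 * kappa by rewrite /kappa; lra.
have rho1 : rho < 1 by rewrite /rho; lra.
have [|| x2 x20 h2] := cvg_right0_near cv (a := kappa) (b := rho).
- by rewrite /kappa; lra.
- by rewrite /rho; lra.
have x0 : 0 < Num.min x1 x2 by rewrite lt_min x10.
have hk x : 0 < x -> x < Num.min x1 x2 -> kappa * levy_tail mu x <= levy_tail mu (2 * x).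
  move=> xp; rewrite lt_min => /andP[xx1 xx2]; have /andP[h _] := h2 x xp xx2.
  by rewrite -ler_pdivlMr ?t0// ltW.
have C0 : 0 < (2 * kappa - 1)^-1 by rewrite invr_gt0; lra.
apply: (conclusion_of_small_jumps hmu hphi hq x0 C0 rho1).
- by move=> x xp; rewrite lt_min => /andP[xx1 xx2]; exact: t0.
- by move=> x xp xx; exact: (levy_min_le_regular hmu k1 hk).
- move=> x xp; rewrite lt_min => /andP[xx1 xx2]; have /andP[_ h] := h2 x xp xx2.
  by rewrite -ler_pdivrMr ?t0// ltW.
Qed.
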